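(* Let $X=(V,E,\mathrm{rt},V_\bullet)$ be a $2$-colored rooted tree with $\mathrm{rt}\in V_\bullet$ and let $\boldsymbol{k}=(k_e)_{e\in E}$ be an essentially positive index on $X$. Then in $\mathfrak{H}^1[[t]]$, $$\widehat{\phi}\bigl(w(X_{\mathrm h},\boldsymbol{k}_{\mathrm h})\bigr)=\sum_{v\in V_\bullet}(-1)^{k_{P(\mathrm{rt},v)}}\sum_{\boldsymbol{l}\in\mathbb{Z}_{\ge0}^{P(\mathrm{rt},v)}} b_{P(\mathrm{rt},v)}\binom{\boldsymbol{k}}{\boldsymbol{l}}\; w\bigl(X_{v,\mathrm h},(\boldsymbol{k}+\boldsymbol{l})_{\mathrm h}\bigr)\,t^{l_{P(\mathrm{rt},v)}},$$ where $X_v:=(V,E,v,V_\bullet)$ and $\boldsymbol{k}+\boldsymbol{l}$ is the index on $X_v$ given by $k_e+l_e$ for $e\in P(\mathrm{rt},v)$ and $k_e$ otherwise. In particular (taking constant terms in $t$), $$\phi\bigl(w(X_{\mathrm h},\boldsymbol{k}_{\mathrm h})\bigr)=\sum_{v\in V_\bullet}(-1)^{k_{P(\mathrm{rt},v)}}\,w(X_{v,\mathrm h},\boldsymbol{k}_{\mathrm h}).$$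
   Context: Algebraic setup. $\mathfrak{H}=\mathbb{Q}\langle x,y\rangle$ is the noncommutative polynomial ring, $\mathfrak{H}^1=\mathbb{Q}+y\mathfrak{H}$, $z_k=yx^{k-1}$ for $k\ge1$. For an index (tuple of positive integers) $\boldsymbol{k}=(k_1,\dots,k_r)$, $z_{\boldsymbol{k}}=z_{k_1}\cdots z_{k_r}$ and $z_\varnothing=1$. The shuffle product $ш$ on $\mathfrak{H}$ is the $\mathbb{Q}$-bilinear map with $a\,ш\,1=1\,ш\,a=a$ and $(a_1u_1)ш(a_2u_2)=(a_1ш a_2u_2)u_1+(a_1u_1ш a_2)u_2$ for $a_1,a_2\in\mathfrak{H}$, $u_1,u_2\in\{x,y\}$; it is extended $\mathbb{Q}[[t]]$-bilinearly. For tuples $\boldsymbol{k}=(k_1,\dots,k_r)$, $\boldsymbol{l}=(l_1,\dots,l_r)$ of nonnegative integers: $\mathrm{wt}(\boldsymbol{k})=k_1+\dots+k_r$, $\overline{\boldsymbol{k}}=(k_r,\dots,k_1)$, $\boldsymbol{k}+\boldsymbol{l}=(k_1+l_1,\dots,k_r+l_r)$, $b\binom{\boldsymbol{k}}{\boldsymbol{l}}=\prod_{i=1}^r\binom{k_i+l_i-1}{l_i}$ with the convention $\binom{l-1}{l}=\delta_{l,0}$, $\boldsymbol{k}_{[i]}=(k_1,\dots,k_i)$, $\boldsymbol{k}^{[i]}=(k_{i+1},\dots,k_r)$. The $t$-adic symmetrization map is the $\mathbb{Q}[[t]]$-linear map $\widehat{\phi}:\mathfrak{H}^1[[t]]\to\mathfrak{H}^1[[t]]$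 given on an index $\boldsymbol{k}$ of depth $r$ by $$\widehat{\phi}(z_{\boldsymbol{k}})=\sum_{i=0}^r(-1)^{\mathrm{wt}(\boldsymbol{k}^{[i]})}z_{\boldsymbol{k}_{[i]}}\,ш\sum_{\boldsymbol{l}\in\mathbb{Z}_{\ge0}^{r-i}}b\binom{\boldsymbol{k}^{[i]}}{\boldsymbol{l}}z_{\overline{\boldsymbol{k}^{[i]}+\boldsymbol{l}}}\,t^{\mathrm{wt}(\boldsymbol{l})},$$ and $\phi=\widehat{\phi}|_{\mathfrak{H}^1}$ followed by setting $t=0$ (i.e. the constant term). For $M\ge0$, $Z_M:\mathfrak{H}^1\to\mathbb{Q}$ is the $\mathbb{Q}$-linear map with $Z_M(z_{\boldsymbol{k}})=\sum_{0<n_1<\dots<n_r<M}n_1^{-k_1}\cdots n_r^{-k_r}$ (empty sum $=0$, $Z_M(1)=1$). Trees. A $2$-colored rooted tree is $X=(V,E,\mathrm{rt},V_\bullet)$ where $(V,E)$ is a finite tree, $\mathrm{rt}\in V$ (the root), and $V_\bullet\subset V$ contains all vertices of degree $1$. Trees are non-planar (no ordering of children). An index on $X$ is $\boldsymbol{k}=(k_e)_{e\in E}\in\mathbb{Z}_{\ge0}^E$. $P(v,v')$ denotes the set of edges on the path from $v$ to $v'$; for $E'\subset E$, $k_{E'}=\sum_{e\in E'}k_e$; for $E_0\subset E$ and families $\boldsymbol{k},\boldsymbol{l}$ defined on $E_0$, $b_{E_0}\binom{\boldsymbol{k}}{\boldsymbol{l}}=\prod_{e\in E_0}\binom{k_e+l_e-1}{l_e}$.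 $\boldsymbol{k}$ is essentially positive if $k_{P(v,v')}>0$ for all distinct $v,v'\in V_\bullet$. For $\mathrm{rt}\in V_\bullet$, $$\zeta_M(X;\boldsymbol{k})=\sum_{\substack{(m_v)\in\mathbb{Z}_{\ge1}^{V_\bullet}\\ \sum_v m_v=M}}\prod_{e\in E}\Bigl(\sum_{v\in V_\bullet,\ e\in P(\mathrm{rt},v)}m_v\Bigr)^{-k_e}.$$ The element $w(X_{\mathrm h},\boldsymbol{k}_{\mathrm h})$. For such $(X,\boldsymbol{k})$ with $\mathrm{rt}\in V_\bullet$ and $\boldsymbol{k}$ essentially positive, $(X_{\mathrm h},\boldsymbol{k}_{\mathrm h})$ is its ''harvestable form'' (obtained by contracting edges, joining edges and inserting white vertices), and $w(X_{\mathrm h},\boldsymbol{k}_{\mathrm h})\in\mathfrak{H}^1$ is the associated word. For the purposes of this statement it is characterized as the unique element $w\in\mathfrak{H}^1$ such that $Z_M(w)=\zeta_M(X;\boldsymbol{k})$ for all $M\ge0$ (such an element exists, and it is unique because the family $(Z_M)_{M\ge0}$ separates elements of $\mathfrak{H}^1$). For example, if $X$ is the linear tree with vertices $v_1,\dots,v_{r+1}$, edges $e_a=\{v_a,v_{a+1}\}$, all vertices black and root $v_{r+1}$, then $w(X_{\mathrm h},\boldsymbol{k}_{\mathrm h})=z_{k_{e_1}}\cdots z_{k_{e_r}}$ when all $k_{e_a}>0$. *)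

(* Defs.v *)
From mathcomp Require Import all_boot all_order all_algebra.
Set Implicit Arguments. Unset Strict Implicit. Unset Printing Implicit Defensive.
Import Order.TTheory GRing.Theory Num.Theory.
Local Open Scope ring_scope.

Definition word := seq bool.
Definition lx : bool := false.
Definition ly : bool := true.

Definition zk (k : nat) : word := ly :: nseq k.-1 lx.
Definition zw (ks : seq nat) : word := flatten (map zk ks).

(* Shuffle of words, following the recursive definition
   (a1 u1) sh (a2 u2) = (a1 sh a2 u2) u1 + (a1 u1 sh a2) u2,
   computed on reversed words; the result is a multiset (seq) of words. *)
Fixpoint shr (a : word) : word -> seq word :=
  match a with
  | [::] => fun b => [:: b]
  | u1 :: a1 =>
      fix shr_b (b : word) : seq word :=
        match b with
        | [::] => [:: a]
        | u2 :: b1 => map (cons u1) (shr a1 b) ++ map (cons u2) (shr_b b1)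
        end
  end.
Definition shw (a b : word) : seq word := map (@rev bool) (shr (rev a) (rev b)).

(* Elements of H = Q<x,y> as formal finite linear combinations.        *)
(* Two combinations are equal in H iff their coefficients agree.       *)
Definition Hel := seq (rat * word).
Definition coef (p : Hel) (u : word) : rat := \sum_(q <- p | q.2 == u) q.1.
Definition Hscale (c : rat) (p : Hel) : Hel := [seq (c * q.1, q.2) | q <- p].
Definition Hsh (p q : Hel) : Hel :=
  flatten [seq [seq (a.1 * b.1, u) | u <- shw a.2 b.2] | a <- p, b <- q].
Definition Hword (u : word) : Hel := [:: (1, u)].

(* decomposition of a word: returns (ks, c) where the word is
   x^c z_{ks}; it lies in H^1 = Q + yH iff c = 0 *)
Definition wstep (l : bool) (st : seq nat * nat) : seq nat * nat :=
  if l then ((st.2).+1 :: st.1, 0%N) else (st.1, (st.2).+1).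
Definition wdec (u : word) : seq nat * nat := foldr wstep ([::], 0%N) u.

Definition inH1 (p : Hel) : Prop := forall u, coef p u != 0 -> (wdec u).2 = 0%N.

(* Z_M(z_k) = sum_{0<n_1<...<n_r<M} n_1^{-k_1}...n_r^{-k_r};
   Zrev takes the index reversed (k_r first). *)
Fixpoint Zrev (ks : seq nat) (M : nat) : rat :=
  match ks with
  | [::] => 1
  | k :: ks' => \sum_(1 <= n < M) (n%:R ^- k) * Zrev ks' n
  end.
Definition Zidx (M : nat) (ks : seq nat) : rat := Zrev (rev ks) M.
Definition ZMw (M : nat) (u : word) : rat :=
  if (wdec u).2 == 0%N then Zidx M (wdec u).1 else 0.
Definition ZM (M : nat) (p : Hel) : rat := \sum_(q <- p) q.1 * ZMw M q.2.

(* The t-adic symmetrization map.  An element of H^1[[t]] is given by  *)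
(* its sequence of t-coefficients n |-> (coefficient of t^n) : Hel.    *)
Fixpoint comps (m n : nat) : seq (seq nat) :=
  match m with
  | 0 => if n == 0%N then [:: [::]] else [::]
  | m'.+1 => flatten [seq map (cons j) (comps m' (n - j)) | j <- iota 0 n.+1]
  end.

(* b(k; l) = prod binom(k_i + l_i - 1, l_i); the nat binomial with
   truncated subtraction gives binom(l-1, l) = delta_{l,0} for k_i = 0 *)
Definition bidx (ks ls : seq nat) : nat := \prod_(p <- zip ks ls) 'C(p.1 + p.2 - 1, p.2).
Definition addidx (ks ls : seq nat) : seq nat := [seq (p.1 + p.2)%N | p <- zip ks ls].

Definition phiw (n : nat) (ks : seq nat) : Hel :=
  flatten [seq Hscale ((-1) ^+ sumn (drop i ks))
                 (Hsh (Hword (zw (take i ks)))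
                      (flatten [seq Hscale (bidx (drop i ks) l)%:R
                                       (Hword (zw (rev (addidx (drop i ks) l))))
                               | l <- comps (size ks - i) n]))
          | i <- iota 0 (size ks).+1].

Definition phihat (n : nat) (p : Hel) : Hel :=
  flatten [seq Hscale q.1 (phiw n (wdec q.2).1) | q <- p].
Definition phi (p : Hel) : Hel := phihat 0 p.

(* 2-colored rooted trees.  Vertices: a finType V; edges: a set E of   *)
(* 2-element subsets of V; indices: functions {set V} -> nat (only     *)
(* their values on E matter).                                          *)
Section Trees.
Variable V : finType.
Variable E : {set {set V}}.

Definition adjE : rel V := fun a b => [set a; b] \in E.

Definition is_tree : bool :=
  [&& [forall e in E, #|e| == 2%N],
      [forall a, forall b, connect adjE a b] &
      #|E|.+1 == #|V| ].

Definition on_path (v v' : V) (e : {set V}) : bool :=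
  [exists n : 'I_#|V|, exists s : n.-tuple V,
     [&& path adjE v s, last v s == v', uniq (v :: s) &
         e \in [seq [set p.1; p.2] | p <- zip (v :: s) s]]].

Definition tpath (v v' : V) : {set {set V}} := [set e in E | on_path v v' e].

Definition ksum (k : {set V} -> nat) (P : {set {set V}}) : nat := (\sum_(e in P) k e)%N.

Definition leaves_black (Vb : {set V}) : bool :=
  [forall v, (#|[set e in E | v \in e]| == 1%N) ==> (v \in Vb)].

Definition ess_pos (Vb : {set V}) (k : {set V} -> nat) : bool :=
  [forall v in Vb, forall v' in Vb, (v != v') ==> (0 < ksum k (tpath v v'))%N].

(* zeta_M(X; k) for X = (V, E, rt, Vb) with rt in Vb; the family
   (m_v)_{v in Vb} is encoded as m : V -> 'I_M.+1 vanishing off Vb *)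
Definition zeta (rt : V) (Vb : {set V}) (k : {set V} -> nat) (M : nat) : rat :=
  \sum_(m : {ffun V -> 'I_M.+1} |
          [forall v, (v \in Vb) == (0 < m v)%N] && ((\sum_(v in Vb) (m v : nat))%N == M))
     \prod_(e in E) (((\sum_(v in Vb | e \in tpath rt v) (m v : nat))%N)%:R ^- k e).

(* w is the word w(X_h, k_h) of (V, E, rt, Vb) with index k:
   the element of H^1 with Z_M(w) = zeta_M(X; k) (M >= 1) *)
Definition is_w (rt : V) (Vb : {set V}) (k : {set V} -> nat) (w : Hel) : Prop :=
  inH1 w /\ forall M : nat, (0 < M)%N -> ZM M w = zeta rt Vb k M.

(* admissible l in Z_{>=0}^{P(rt,v)} with wt(l) = n, encoded as
   functions on {set V} vanishing off P(rt,v) *)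
Definition adm_l (rt v : V) (n : nat) (l : {ffun {set V} -> 'I_n.+1}) : bool :=
  [forall e, (e \notin tpath rt v) ==> (l e == 0%N :> nat)] &&
  ((\sum_(e in tpath rt v) (l e : nat))%N == n).

Definition bP (rt v : V) (k : {set V} -> nat) (l : {set V} -> nat) : nat :=
  (\prod_(e in tpath rt v) 'C(k e + l e - 1, l e))%N.

(* coefficient of t^n in the right-hand side, given the words
   W v l = w(X_{v,h}, (k+l)_h) *)
Definition rhs (rt : V) (Vb : {set V}) (k : {set V} -> nat)
    (W : V -> ({set V} -> nat) -> Hel) (n : nat) : Hel :=
  flatten [seq flatten [seq Hscale ((-1) ^+ ksum k (tpath rt v) *
                                    (bP rt v k (fun e => nat_of_ord (l e)))%:R)
                                   (W v (fun e => nat_of_ord (l e)))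
                       | l : {ffun {set V} -> 'I_n.+1} <- enum (adm_l rt v (n := n))]
          | v <- enum Vb].

End Trees.

(* Main.v *)
From HB Require Import structures.
Require Import Defs.
From mathcomp Require Import all_boot all_order all_algebra.
From mathcomp Require Import ring lra zify qpoly.
Set Implicit Arguments. Unset Strict Implicit. Unset Printing Implicit Defensive.
Import Order.TTheory GRing.Theory Num.Theory.
Local Open Scope ring_scope.

(* For a variable [T] and [m : Vb -> nat] with [\sum m = M], put
   [f m = \prod_e s_e ^ - k_e], where [s_e] sums [m] over the vertices beyond [e]
   as seen from [rt]. Expanding [(T - c) ^ - k] in powers of [T] identifies [Z_M]
   of the right-hand side with
     [\sum_(v in Vb) \sum_m f (m + (T - M) * delta_v)],
   since rerooting at [v] replaces [s_e] by [M - s_e] on the path from [rt] to [v].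
   By essential positivity a partial fraction expansion writes [f], as a rational
   function of [m], as a sum of products along chains of subsets of [Vb], i.e. of
   the analogous functions of linear trees. For a linear tree the double sum is
   [Z_M] of [phihat (z_k)], because the shuffle product is the product of multiple
   polylogarithms. Hence the word given by the expansion has both the truncated
   values [zeta_M] and the required symmetrization, and it is equal to [w] since
   the maps [Z_M] separate the elements of [H^1]. *)

(** * Independence of truncated multiple harmonic sums over polynomials *)

(** The harvestable form is never built: a word enters only through its values [Z_M], so equalities
    in H^1 are tested on these values, one coefficient of t^n at a time. For this, [T] lives in the
    quotient of [rat[X]] by [X^(n+1)], where [T - c] is a unit for every integer c > 0. The shifted
    variables add up to [T]. A sum over a set containing the shifted vertex is therefore [T - c],
    with c the sum of [m] over the complement, and c > 0 because the sets of the expansion avoid the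
    root. Hence partial fractions are proved over any commutative ring in which the subset sums are
    units, with the list of chains chosen before the ring: one list gives [zeta_M] over [rat] and
    the symmetrization over the truncated series. Separation by the [Z_M] is proved for coefficients
    that are polynomials in M, because comparing a relation at M and at M + 1 multiplies its
    coefficients by polynomials. *)

Definition pshift (p : {poly rat}) : {poly rat} := p \Po ('X + 1%:P).

Lemma horner_pshift p x : (pshift p).[x] = p.[x + 1].
Proof. by rewrite /pshift horner_comp !hornerE. Qed.

Lemma pshiftM p q : pshift (p * q) = pshift p * pshift q.
Proof. exact: comp_polyM. Qed.

Lemma pshift_neq0 p : p != 0 -> pshift p != 0.
Proof.
by rewrite /pshift comp_poly_eq0 // size_XaddC.
Qed.

Lemma poly_eq0_of_nat_roots (p : {poly rat}) (x e : rat) :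
  e != 0 -> (forall i : nat, root p (x + e * i%:R)) -> p = 0.
Proof.
move=> e0 hr; apply: (@roots_geq_poly_eq0 _ p [seq x + e * i%:R | i <- iota 0 (size p)]).
- by apply/allP => y /mapP[i _ ->].
- rewrite map_inj_uniq ?iota_uniq // => i j /addrI /(mulfI e0) /eqP.
  by rewrite eqr_nat => /eqP.
- by rewrite size_map size_iota.
Qed.

Lemma coprime_reduction (A B : {poly rat}) : B != 0 ->
  exists g A1 B1 : {poly rat},
    [/\ g != 0, A = A1 * g, B = B1 * g, B1 != 0 & coprimep A1 B1].
Proof.
move=> B0; exists (gcdp A B), (A %/ gcdp A B), (B %/ gcdp A B).
have g0 : gcdp A B != 0 by rewrite gcdp_eq0 negb_and B0 orbT.
split => //; rewrite ?divpK ?dvdp_gcdl ?dvdp_gcdr //.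
- by apply: contra_neq B0 => h; rewrite -(divpK (dvdp_gcdr A B)) h mul0r.
- by apply: coprimep_div_gcd; rewrite B0 orbT.
Qed.

(** In lowest terms, periodicity sends a root x of the denominator to the root x + 1, hence to
    infinitely many. Without rational roots, the ratio is defined at all natural numbers and keeps
    its value at 0 there. *)
Lemma shift_ratio_const (A B : {poly rat}) : B != 0 ->
  B * pshift A = pshift B * A -> exists c : rat, A = c *: B.
Proof.
move=> B0 /eqP hAB.
have [g [A1 [B1 [g0 eA eB B10 cop]]]] := coprime_reduction A B0.
have h1 : B1 * pshift A1 = pshift B1 * A1.
  have gg : g * pshift g != 0 by rewrite mulf_neq0 // pshift_neq0.
  apply: (mulfI gg); move/eqP: hAB; rewrite eA eB !pshiftM => h.
  by ring: h.
have nr x : ~~ root B1 x.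
  apply/negP => hx; move/eqP: B10; apply.
  apply: (@poly_eq0_of_nat_roots B1 x 1); rewrite ?oner_neq0 //.
  elim=> [|i IH]; first by rewrite mulr0 addr0.
  have := congr1 (horner^~ (x + 1 * i%:R)) h1; rewrite !hornerM !horner_pshift.
  rewrite (rootP IH) mul0r => /esym/eqP; rewrite mulf_eq0.
  rewrite (negbTE (coprimep_root _ IH)); last by rewrite coprimep_sym.
  by rewrite orbF -addrA !mul1r natr1; apply.
exists (A1.[0] / B1.[0]); rewrite eA eB scalerAl; congr (_ * _).
apply/eqP; rewrite -subr_eq0; apply/eqP.
apply: (@poly_eq0_of_nat_roots _ 0 1); rewrite ?oner_neq0 //.
have nB x : B1.[x] != 0 by exact: nr.
elim=> [|i]; rewrite /root !hornerE; first by rewrite divfK ?subrr.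
rewrite -natr1 => /eqP IH.
have := congr1 (horner^~ i%:R) h1; rewrite !hornerM !horner_pshift => h2.
apply/eqP/(mulfI (nB i%:R)); rewrite mulrBr h2 mulr0.
move: IH; move: (A1.[0] / B1.[0]) => c /subr0_eq ->; ring.
Qed.

(** With rho = A / B the hypothesis reads rho(x + 1) - rho(x) = - C / x^K, whose only possible pole
    is 0. A rational pole of rho propagates upwards until it reaches 0 and downwards until it
    reaches 1, so it would be both <= 0 and >= 1. Hence the reduced denominator is prime to X^K,
    which then divides C. *)
Lemma shift_difference_pole (A B C : {poly rat}) (K : nat) : B != 0 ->
  (size C <= K)%N ->
  'X^K * (pshift A * B - A * pshift B) + C * B * pshift B = 0 -> C = 0.
Proof.
move=> B0 sC hAB.
have [g [A1 [B1 [g0 eA eB B10 cop]]]] := coprime_reduction A B0.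
have h1 : 'X^K * (pshift A1 * B1 - A1 * pshift B1) + C * B1 * pshift B1 = 0.
  have gg : g * pshift g != 0 by rewrite mulf_neq0 // pshift_neq0.
  by apply: (mulfI gg); move: hAB; rewrite eA eB !pshiftM mulr0 => h; rewrite -[RHS]h; ring.
have h2 x : x ^+ K * (A1.[x + 1] * B1.[x] - A1.[x] * B1.[x + 1]) +
            C.[x] * B1.[x] * B1.[x + 1] = 0.
  by have := congr1 (horner^~ x) h1; rewrite !hornerE !horner_pshift.
have up x : root B1 x -> exists i : nat, x + i%:R = 0.
  move=> hx; case: (boolP [forall i : 'I_(size B1), x + i%:R != 0]); last first.
    by rewrite negb_forall => /existsP[i]; rewrite negbK => /eqP; exists i.
  move=> /forallP hi.
  have hr i : (i <= size B1)%N -> root B1 (x + i%:R).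
    elim: i => [|i IH] li; first by rewrite addr0.
    have {}IH := IH (ltnW li); have := h2 (x + i%:R).
    rewrite (rootP IH) mulr0 sub0r mulr0 mul0r addr0 => /eqP.
    rewrite mulf_eq0 expf_eq0 (negbTE (hi (Ordinal li))) andbF /=.
    rewrite oppr_eq0 mulf_eq0 (negbTE (coprimep_root _ IH)) ?[coprimep _ A1]coprimep_sym //=.
    by rewrite -addrA natr1; apply.
  exfalso; move/eqP: B10; apply.
  apply: (@roots_geq_poly_eq0 _ B1 [seq x + i%:R | i <- iota 0 (size B1)]).
  - by apply/allP => y /mapP[i]; rewrite mem_iota => /andP[_ ?] ->; apply/hr/ltnW.
  - rewrite map_inj_uniq ?iota_uniq // => i j /addrI /eqP.
    by rewrite eqr_nat => /eqP.
  - by rewrite size_map size_iota.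
have down x : root B1 x -> exists i : nat, x - 1 - i%:R = 0.
  move=> hx; case: (boolP [forall i : 'I_(size B1), x - 1 - i%:R != 0]); last first.
    by rewrite negb_forall => /existsP[i]; rewrite negbK => /eqP; exists i.
  move=> /forallP hi.
  have hr i : (i <= size B1)%N -> root B1 (x - i%:R).
    elim: i => [|i IH] li; first by rewrite subr0.
    have {}IH := IH (ltnW li); have := h2 (x - 1 - i%:R).
    have -> : x - 1 - i%:R + 1 = x - i%:R by ring.
    rewrite (rootP IH) !mulr0 subr0 addr0 => /eqP.
    rewrite mulf_eq0 expf_eq0 (negbTE (hi (Ordinal li))) andbF /=.
    rewrite mulf_eq0 (negbTE (coprimep_root _ IH)) ?[coprimep _ A1]coprimep_sym //=.
    by rewrite -addrA -opprD nat1r; apply.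
  exfalso; move/eqP: B10; apply.
  apply: (@roots_geq_poly_eq0 _ B1 [seq x - i%:R | i <- iota 0 (size B1)]).
  - by apply/allP => y /mapP[i]; rewrite mem_iota => /andP[_ ?] ->; apply/hr/ltnW.
  - rewrite map_inj_uniq ?iota_uniq // => i j /addrI/oppr_inj /eqP.
    by rewrite eqr_nat => /eqP.
  - by rewrite size_map size_iota.
have nr x : ~~ root B1 x.
  apply/negP => hx; have [i hi] := up _ hx; have [j hj] := down _ hx.
  have := ler0n rat i; have := ler0n rat j; lra.
apply/eqP; apply: contraTT sC => C0; rewrite -ltnNge.
have : 'X^K %| C * (B1 * pshift B1).
  rewrite mulrA; apply/dvdpP; exists (- (pshift A1 * B1 - A1 * pshift B1)).
  by move/eqP: h1; rewrite addrC addr_eq0 => /eqP ->; ring.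
rewrite Gauss_dvdpl; last first.
  apply: coprimep_expl; rewrite coprimep_sym coprimepX rootM negb_or nr.
  by rewrite /root horner_pshift nr.
by move=> /(dvdp_leq C0); rewrite size_polyXn.
Qed.

Lemma sum_by_key (Z : nmodType) (I K : eqType) (p : seq I) (key : I -> K)
    (S : seq K) (G : I -> Z) :
  uniq S -> {subset map key p <= S} ->
  \sum_(q <- p) G q = \sum_(s <- S) \sum_(q <- p | key q == s) G q.
Proof.
move=> uS sub; rewrite (exchange_big_dep predT) //=.
rewrite big_seq [RHS]big_seq; apply: eq_bigr => q qp.
rewrite -big_filter (_ : [seq s <- S | key q == s] = [:: key q]) ?big_seq1 //.
rewrite (eq_filter (a2 := pred1 (key q))) => [|s]; last by rewrite /= eq_sym.
by rewrite filter_pred1_uniq // sub // map_f.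
Qed.

Definition rel_eval (p : seq ({poly rat} * seq nat)) (n : nat) : rat :=
  \sum_(q <- p) q.1.[n%:R] * Zrev q.2 n.

Definition pcoef (p : seq ({poly rat} * seq nat)) (s : seq nat) : {poly rat} :=
  \sum_(q <- p | q.2 == s) q.1.

Lemma rel_eval_pcoef p S n : uniq S -> {subset map snd p <= S} ->
  rel_eval p n = \sum_(s <- S) (pcoef p s).[n%:R] * Zrev s n.
Proof.
move=> uS sub; rewrite /rel_eval (sum_by_key _ uS sub); apply: eq_bigr => s _.
by rewrite /pcoef horner_sum mulr_suml; apply: eq_bigr => q /eqP ->.
Qed.

Lemma Zrev_succ k ks n : (0 < n)%N ->
  Zrev (k :: ks) n.+1 = Zrev (k :: ks) n + n%:R ^- k * Zrev ks n.
Proof. by move=> n0 /=; rewrite big_nat_recr. Qed.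

Lemma poly_eq0_of_pos_nat_roots (p : {poly rat}) :
  (forall n : nat, (0 < n)%N -> p.[n%:R] = 0) -> p = 0.
Proof.
move=> h; apply: (@poly_eq0_of_nat_roots p 1 1); rewrite ?oner_neq0 // => i.
by apply/rootP; rewrite mul1r nat1r h.
Qed.

(** Cross-multiplication cancels a term with coefficient [R0]. The second list collects what the
    last summand [n ^- k] of a sum up to [n] adds, one depth lower; ['X^K] clears its
    denominator. *)
Definition elim_shift (K : nat) (R0 : {poly rat}) (p : seq ({poly rat} * seq nat)) :=
  [seq ('X^K * (R0 * pshift q.1 - pshift R0 * q.1), q.2) | q <- p] ++
  [seq (R0 * pshift q.1 * 'X^(K - head 0%N q.2), behead q.2) | q <- p & q.2 != [::]].

Lemma rel_eval_elim_shift K R0 p n : (0 < n)%N ->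
  all (fun q => head 0%N q.2 <= K)%N p ->
  rel_eval (elim_shift K R0 p) n =
  n%:R ^+ K * (R0.[n%:R] * rel_eval p n.+1 - R0.[n%:R + 1] * rel_eval p n).
Proof.
move=> n0 /allP hK; rewrite /rel_eval /elim_shift big_cat !big_map big_filter /=.
rewrite [X in _ + X]big_mkcond -big_split /= !mulr_sumr -sumrB mulr_sumr.
rewrite big_seq [RHS]big_seq; apply: eq_bigr => -[q s] /hK /= hs.
rewrite !hornerE !horner_pshift.
case: s hs => [|k s] /= hk; first by rewrite -natr1; ring.
rewrite -[\sum_(1 <= i < n.+1) _]/(Zrev (k :: s) n.+1) Zrev_succ //= natr1.
have -> : n%:R ^+ K = n%:R ^+ (K - k) * n%:R ^+ k :> rat by rewrite -exprD subnK.
move: (\sum_(1 <= i < n) _) => z; field.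
by rewrite ?expf_neq0 ?pnatr_eq0 -?lt0n.
Qed.

Lemma pcoef_cat p q s : pcoef (p ++ q) s = pcoef p s + pcoef q s.
Proof. exact: big_cat. Qed.

Lemma pcoef_elim_shift K R0 p s :
  pcoef (elim_shift K R0 p) s =
  'X^K * (R0 * pshift (pcoef p s) - pshift R0 * pcoef p s) +
  \sum_(q <- p | (q.2 != [::]) && (behead q.2 == s))
     R0 * pshift q.1 * 'X^(K - head 0%N q.2).
Proof.
rewrite pcoef_cat; congr (_ + _); rewrite /pcoef big_map /=.
  by rewrite [pshift (bigop _ _ _)]raddf_sum /= !mulr_sumr -sumrB mulr_sumr.
by rewrite big_filter_cond.
Qed.

Lemma pcoef_elim_shift_behead K R0 p s :
  all (fun q => head 0%N q.2 <= K)%N p ->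
  \sum_(q <- p | (q.2 != [::]) && (behead q.2 == s))
     R0 * pshift q.1 * 'X^(K - head 0%N q.2) =
  \sum_(h < K.+1) R0 * pshift (pcoef p (nat_of_ord h :: s)) * 'X^(K - h).
Proof.
move=> /allP hK.
under [RHS]eq_bigr => h _.
  rewrite [pshift _]raddf_sum /= mulr_sumr mulr_suml.
  over.
rewrite [RHS](exchange_big_dep (fun q => (q.2 != [::]) && (behead q.2 == s))) /=; last first.
  by move=> h q _ /eqP ->; rewrite /= eqxx.
rewrite big_seq_cond [RHS]big_seq_cond; apply: eq_bigr => -[q [|k t]] //=.
  by rewrite andbF.
move=> /andP[/hK /= kK /eqP ->].
rewrite (big_pred1 (Ordinal (kK : k < K.+1)%N)) //= => h /=.
by rewrite eqseq_cons eqxx andbT eq_sym.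
Qed.

Lemma pcoef_notin p s : s \notin map snd p -> pcoef p s = 0.
Proof.
move=> h; rewrite /pcoef big_seq_cond big1 // => q /andP[qp /eqP e].
by case/negP: h; rewrite -e map_f.
Qed.

(* Downward induction on the top-depth coefficients: eliminating one of them by
   a shift shows that the ratios of the top-depth coefficients are constants [c_k],
   and the next lower coefficient yields a rational solution of
   [rho (n + 1) - rho n = - \sum_k c_k / n ^ k]. *)
Lemma pcoef_eq0 d (p : seq ({poly rat} * seq nat)) :
  (forall q, q \in p -> (size q.2 <= d)%N && all (leq 1) q.2) ->
  (forall n, (0 < n)%N -> rel_eval p n = 0) -> forall s, pcoef p s = 0.
Proof.
elim: d p => [|d IHd] p hp rel s.
  have hs q : q \in p -> q.2 = [::] by move=> /hp /andP[]; rewrite leqn0 => /nilP.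
  case: (eqVneq s [::]) => [->|sn]; last first.
    by apply: pcoef_notin; apply: contra sn => /mapP[q /hs -> ->].
  apply: poly_eq0_of_pos_nat_roots => n n0; rewrite -(rel n n0).
  rewrite (rel_eval_pcoef (S := [:: [::]])) ?big_seq1 ?mulr1 //.
  by move=> t /mapP[q /hs e ->]; rewrite e inE.
(* Inner induction on a list containing the support in depth [d.+1]: an elimination removes [s0]
   from it and adds nothing, since the extra terms have smaller depth. *)
have : forall t, size t = d.+1 -> pcoef p t != 0 -> t \in map snd p.
  by move=> t _; apply: contraR => /pcoef_notin/eqP.
move: (map snd p) => S; elim: S p hp rel s => [|s0 S IHS] p hp rel s hS.
  have h0 t : size t = d.+1 -> pcoef p t = 0.
    by move=> st; apply/eqP/negPn/negP => /(hS t st).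
  case: (leqP (size s) d) => sd; last first.
    case: (eqVneq (size s) d.+1) => [/h0 //|ne]; apply: pcoef_notin.
    by apply/negP => /mapP[q /hp /andP[qd _] e]; rewrite eqn_leq sd e qd in ne.
  pose p0 := [seq q <- p | (size q.2 <= d)%N].
  have e0 t : pcoef p0 t = if (size t <= d)%N then pcoef p t else 0.
    rewrite /pcoef big_filter_cond; case: ifP => td.
      by apply: eq_bigl => q; case: eqP => [->|]; rewrite ?td ?andbF.
    by rewrite big1 // => q /andP[+ /eqP e]; rewrite e td.
  have := IHd p0 _ _ s; rewrite e0 sd; apply.
    by move=> q; rewrite mem_filter => /andP[-> /hp /andP[]].
  move=> n n0; rewrite -(rel n n0).
  rewrite !(rel_eval_pcoef (S := undup (map snd p))) ?undup_uniq //.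
  - rewrite big_seq [RHS]big_seq; apply: eq_bigr => t; rewrite mem_undup => /mapP[q /hp].
    move=> /andP[qd _] ->; rewrite e0; case: (leqP (size q.2) d) => // qd'.
    by rewrite h0 //; apply/eqP; rewrite eqn_leq qd qd'.
  - by move=> t; rewrite mem_undup.
  - by move=> t /mapP[q]; rewrite mem_filter mem_undup => /andP[_ ?] ->; exact: map_f.
case: (eqVneq (pcoef p s0) 0) => [z0|nz0].
  apply: IHS => // t st nt; have := hS t st nt; rewrite inE => /orP[/eqP e|//].
  by rewrite e z0 eqxx in nt.
pose R0 := pcoef p s0.
case: (eqVneq (size s0) d.+1) => [ss0|ns0]; last first.
  apply: IHS => // t st nt; have := hS t st nt; rewrite inE => /orP[/eqP e|//].
  by rewrite -e st eqxx in ns0.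
pose K := \max_(q <- p) head 0%N q.2.
have hK : all (fun q => head 0%N q.2 <= K)%N p.
  by apply/allP => q qp; rewrite /K (big_rem q qp) leq_maxl.
have hp' q : q \in elim_shift K R0 p -> (size q.2 <= d.+1)%N && all (leq 1) q.2.
  rewrite mem_cat => /orP[] /mapP[r]; rewrite ?mem_filter.
    by move=> /hp hr ->.
  move=> /andP[_ /hp /andP[h1 h2]] -> /=; rewrite size_behead.
  apply/andP; split; first exact: leq_trans (leq_pred _) h1.
  by apply/allP => x /mem_behead; apply/allP.
have lower t : size t = d.+1 ->
    \sum_(q <- p | (q.2 != [::]) && (behead q.2 == t))
       R0 * pshift q.1 * 'X^(K - head 0%N q.2) = 0.
  move=> st; rewrite big_seq_cond big1 // => q /and3P[/hp /andP[+ _]].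
  move=> h1 nq /eqP h2; exfalso; move: st h1; rewrite -h2 size_behead.
  by case: (q.2) nq => //= a l _ ->; rewrite ltnn.
have z' : forall t, pcoef (elim_shift K R0 p) t = 0.
  move=> t; apply: IHS => //.
    by move=> n n0; rewrite rel_eval_elim_shift // !rel // !(mulr0, subr0).
  move=> {}t st; rewrite pcoef_elim_shift lower // addr0 => nt.
  have : t \in s0 :: S.
    apply: hS => //; apply: contraNneq nt => ->.
    by rewrite /pshift comp_poly0 !mulr0 subrr mulr0.
  rewrite inE => /orP[/eqP e|//]; move: nt; rewrite e -/R0 mulrC.
  by rewrite [R0 * _]mulrC subrr mul0r eqxx.
exfalso.
case: s0 ss0 @R0 nz0 hS hp' lower z' => [//|k0 s0] [ss0] R0 nz0 hS hp' lower z'.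
have ratio h : exists c : rat, pcoef p (h :: s0) = c *: R0.
  apply: shift_ratio_const => //; have := z' (h :: s0).
  rewrite pcoef_elim_shift lower /= ?ss0 // addr0 => /eqP.
  by rewrite mulf_eq0 expf_eq0 polyX_eq0 andbF /= subr_eq0 => /eqP.
(* The constant is recovered from the leading coefficient of [R0], so that [c] becomes a function of
   [h]. *)
have {}ratio h : {c : rat | pcoef p (h :: s0) = c *: R0}.
  exists ((pcoef p (h :: s0))`_(size R0).-1 / lead_coef R0).
  have [c ->] := ratio h; rewrite coefZ -/(lead_coef R0) mulfK //.
  by rewrite lead_coef_eq0.
pose c h := sval (ratio h).
have hc h : pcoef p (h :: s0) = c h *: R0 by rewrite /c; case: (ratio h).
have c0 : c 0%N = 0.
  have := hc 0%N; rewrite pcoef_notin.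
    move/esym/eqP; rewrite scaler_eq0 (negbTE nz0) orbF => /eqP; exact.
  by apply/negP => /mapP[q /hp /andP[_ h] e]; rewrite -e in h.
have ck : c k0 = 1.
  have l0 : lead_coef R0 != 0 by rewrite lead_coef_eq0.
  by apply: (mulIf l0); rewrite mul1r -lead_coefZ -hc.
(* [C / 'X^K] is the sum of the [c h / 'X^h]. Its size is at most [K] because [c 0 = 0], and
   [c k0 = 1] contradicts [C = 0]. *)
pose C : {poly rat} := \sum_(h < K.+1) c h *: 'X^(K - h).
have kK : (k0 < K.+1)%N.
  have /mapP[q /(allP hK) + e] : (k0 :: s0) \in map snd p.
    by apply: contraR nz0 => /pcoef_notin/eqP.
  by rewrite -e.
have CK : C`_(K - k0) = 1.
  rewrite coef_sum (bigD1 (Ordinal kK)) //= coefZ coefXn eqxx mulr1 ck.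
  rewrite big1 ?addr0 // => h ne; rewrite coefZ coefXn [_ == _]negbTE ?mulr0 //.
  apply: contra ne => /eqP e; apply/eqP/val_inj => /=.
  by have := ltn_ord h; lia.
suff C0 : C = 0 by move: CK; rewrite C0 coef0 => /eqP; rewrite eq_sym oner_eq0.
apply: (@shift_difference_pole (pcoef p s0) R0 C K) => //.
  apply/leq_sizeP => j Kj; rewrite coef_sum big1 // => h _.
  rewrite coefZ coefXn; case: eqP => [e|]; rewrite ?mulr0 //.
  have -> : h = 0%N :> nat by have := ltn_ord h; lia.
  by rewrite c0 mul0r.
rewrite -(z' s0) pcoef_elim_shift pcoef_elim_shift_behead //.
congr (_ + _).
  by congr (_ * _); rewrite mulrC; congr (_ - _); rewrite mulrC.
rewrite /C -mulrA mulr_suml; apply: eq_bigr => h _.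
rewrite hc /pshift comp_polyZ -!scalerAl -!scalerAr -scalerAl; congr (_ *: _).
by rewrite mulrC.
Qed.

(** * Words, indices and the shuffle product *)

Lemma wdecK u : u = nseq (wdec u).2 lx ++ zw (wdec u).1.
Proof.
elim: u => [//|l u IH]; rewrite [wdec _]/= -/(wdec u) {1}IH.
by case: (wdec u) => ks c; case: l.
Qed.

Lemma wdec_gt0 u : all (leq 1) (wdec u).1.
Proof. by elim: u => [//|[] u IH]; rewrite [wdec _]/= -/(wdec u). Qed.

Lemma wdec_nseq j u : wdec (nseq j lx ++ u) = ((wdec u).1, (j + (wdec u).2)%N).
Proof.
elim: j => [|j IH]; first by case: (wdec u).
by rewrite [nseq _ _ ++ _]/= [LHS]/= -/(wdec _) IH.
Qed.

Lemma wdec_zw ks : all (leq 1) ks -> wdec (zw ks) = (ks, 0%N).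
Proof.
elim: ks => [//|k ks IH] /= /andP[k0 /IH e].
rewrite -/(wdec _) wdec_nseq -[flatten _]/(zw ks) e /wstep /= addn0.
by rewrite prednK.
Qed.

Lemma wdec2_eq0 u : ((wdec u).2 == 0%N) = head true u.
Proof. by case: u => [//|[] u]. Qed.

Lemma coef_cat p q u : coef (p ++ q) u = coef p u + coef q u.
Proof. exact: big_cat. Qed.

Lemma coef_scale c p u : coef (Hscale c p) u = c * coef p u.
Proof. by rewrite /coef big_map mulr_sumr. Qed.

Lemma coef_flatten (I : Type) (r : seq I) (F : I -> Hel) u :
  coef (flatten [seq F i | i <- r]) u = \sum_(i <- r) coef (F i) u.
Proof.
elim: r => [|i r IH]; first by rewrite /coef !big_nil.
by rewrite /= coef_cat big_cons IH.
Qed.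

Lemma ZM_cat M p q : ZM M (p ++ q) = ZM M p + ZM M q.
Proof. exact: big_cat. Qed.

Lemma ZM_scale M c p : ZM M (Hscale c p) = c * ZM M p.
Proof. by rewrite /ZM big_map mulr_sumr; under eq_bigr do rewrite -mulrA. Qed.

Lemma ZM_flatten (I : Type) (r : seq I) (F : I -> Hel) M :
  ZM M (flatten [seq F i | i <- r]) = \sum_(i <- r) ZM M (F i).
Proof.
elim: r => [|i r IH]; first by rewrite /ZM !big_nil.
by rewrite /= ZM_cat big_cons IH.
Qed.

(** A [Hel] is a list and [phihat] is computed on that list; this makes linear maps depend on the
    coefficients alone. *)
Lemma coef_ext (p q : Hel) (F : word -> rat) :
  (forall u, coef p u = coef q u) ->
  \sum_(a <- p) a.1 * F a.2 = \sum_(a <- q) a.1 * F a.2.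
Proof.
move=> h; pose S := undup (map snd p ++ map snd q).
have uS : uniq S by apply: undup_uniq.
rewrite (sum_by_key (key := snd) (S := S)) //; last first.
  by move=> u; rewrite mem_undup mem_cat => ->.
rewrite [RHS](sum_by_key (key := snd) (S := S)) //; last first.
  by move=> u; rewrite mem_undup mem_cat orbC => ->.
apply: eq_bigr => u _.
have aux (r : Hel) : \sum_(a <- r | a.2 == u) a.1 * F a.2 = coef r u * F u.
  by rewrite /coef mulr_suml; apply: eq_bigr => a /eqP ->.
by rewrite !aux h.
Qed.

Lemma coef_phihat n p u :
  coef (phihat n p) u = \sum_(a <- p) a.1 * coef (phiw n (wdec a.2).1) u.
Proof.
by rewrite /phihat coef_flatten; apply: eq_bigr => a _; rewrite coef_scale.
Qed.

Lemma ZM_eq0_coef p : inH1 p -> (forall M, (0 < M)%N -> ZM M p = 0) ->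
  forall u, coef p u = 0.
Proof.
move=> h1 hZ u; apply/eqP; apply/contraT => cu; have u0 := h1 _ cu.
pose p1 := [seq (a.1%:P, rev (wdec a.2).1) | a : rat * word <- p & (wdec a.2).2 == 0%N].
have sz : pcoef p1 (rev (wdec u).1) = 0.
  apply: (@pcoef_eq0 (\max_(a <- p1) size a.2)) => [a ap1|n n0].
    rewrite (big_rem a ap1) leq_maxl /=.
    by have /mapP[b _ ->] := ap1; rewrite all_rev wdec_gt0.
  rewrite -(hZ n n0) /rel_eval big_map big_filter [LHS]big_mkcond.
  apply: eq_bigr => a _; rewrite /ZMw; case: ifP; rewrite ?mulr0 // => _ /=.
  by rewrite hornerC.
case/negP: cu; rewrite -polyC_eq0 -sz /pcoef big_map big_filter_cond /coef.
rewrite raddf_sum /=; apply/eqP/eq_bigl => a.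
apply/eqP/andP => [->|[/eqP a0 /eqP/(can_inj revK) e]]; first by rewrite u0 !eqxx.
by rewrite (wdecK a.2) (wdecK u) e a0 u0.
Qed.

Lemma coef_eq_of_ZM p q : inH1 p -> inH1 q ->
  (forall M, (0 < M)%N -> ZM M p = ZM M q) -> forall u, coef p u = coef q u.
Proof.
move=> hp hq hZ u; apply/eqP; rewrite -subr_eq0 -mulN1r -coef_scale -coef_cat.
apply/eqP; apply: ZM_eq0_coef => [v|M M0]; last first.
  by rewrite ZM_cat ZM_scale hZ // mulN1r subrr.
rewrite coef_cat coef_scale; case: (eqVneq (coef p v) 0) => [->|/hp //].
by rewrite add0r mulN1r oppr_eq0; apply: hq.
Qed.

Lemma inH1_all p : all (fun a => head true a.2) p -> inH1 p.
Proof.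
move=> /allP h u; apply: contraNeq => u0; apply/eqP.
rewrite /coef big_seq_cond big1 // => a /andP[/h + /eqP e].
by rewrite e -wdec2_eq0 (negbTE u0).
Qed.

(* [li_word (rev u) a] is the coefficient of [x ^ a] in the multiple polylogarithm
   [Li_u(x)]. *)
Fixpoint li_word (u : word) (a : nat) : rat :=
  match u with
  | [::] => (a == 0%N)%:R
  | b :: u' => a%:R^-1 * (if b then \sum_(j < a) li_word u' j else li_word u' a)
  end.

Definition conv (f g : nat -> rat) (c : nat) : rat :=
  \sum_(i < c.+1) f i * g (c - i)%N.

Lemma convC (f g : nat -> rat) c : conv f g c = conv g f c.
Proof.
rewrite /conv (reindex_inj rev_ord_inj) /=; apply: eq_bigr => i _.
by rewrite subSS subKn -1?ltnS // mulrC.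
Qed.

Lemma conv_ext (f f' g g' : nat -> rat) c :
  f =1 f' -> g =1 g' -> conv f g c = conv f' g' c.
Proof. by move=> h h'; apply: eq_bigr => i _; rewrite h h'. Qed.

Lemma conv_delta (f : nat -> rat) c : conv (fun i => (i == 0%N)%:R) f c = f c.
Proof.
rewrite /conv big_ord_recl /= mul1r subn0 big1 ?addr0 // => i _.
by rewrite mul0r.
Qed.

(** Strict partial summation is multiplication of the generating series by x / (1 - x). *)
Lemma conv_prefix (f g : nat -> rat) c :
  conv (fun i => \sum_(j < i) f j) g c = \sum_(d < c) conv f g d.
Proof.
elim: c => [|c IH]; first by rewrite /conv big_ord_recl !big_ord0 mul0r addr0.
rewrite big_ord_recr -IH /conv [LHS]big_ord_recl /= big_ord0 mul0r add0r -big_split /=.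
by apply: eq_bigr => i _; rewrite /bump /= add1n subSS big_ord_recr mulrDl.
Qed.

(** The Leibniz rule for x d/dx on generating series. *)
Lemma conv_deriv (f g : nat -> rat) c :
  c%:R * conv f g c =
  conv (fun i => i%:R * f i) g c + conv f (fun i => i%:R * g i) c.
Proof.
rewrite /conv mulr_sumr -[RHS]big_split; apply: eq_bigr => i _ /=.
have {1}-> : c = (i + (c - i))%N by rewrite subnKC // -ltnS.
by rewrite natrD; ring.
Qed.

Lemma li_word0 u : u != [::] -> li_word u 0 = 0.
Proof. by case: u => //= b u _; rewrite invr0 mul0r. Qed.

Lemma shr_nil b : shr [::] b = [:: b]. Proof. by []. Qed.

Lemma shr_nilr a : shr a [::] = [:: a]. Proof. by case: a. Qed.

Lemma shr_cons u1 a u2 b : shr (u1 :: a) (u2 :: b) =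
  map (cons u1) (shr a (u2 :: b)) ++ map (cons u2) (shr (u1 :: a) b).
Proof. by []. Qed.

Lemma last_true_behead b u : last true (b :: u) -> last true u.
Proof. by case: u. Qed.

(** On a reversed word, [last true] means that the word is empty or starts with y, that is, lies in
    H^1. It matters at [i = 0], where the equation fails for the word x. *)
Lemma li_word_deriv b u i : last true (b :: u) ->
  i%:R * li_word (b :: u) i = if b then \sum_(j < i) li_word u j else li_word u i.
Proof.
case: i => [|i] h /=; last by rewrite mulVKf // pnatr_eq0.
rewrite mul0r big_ord0; case: b h => // h.
by rewrite li_word0 //; case: u h.
Qed.

(* Induction on the last letters, since [x * d/dx] is a derivation of power series. *)
Lemma sum_li_word_shr a b c : last true a -> last true b ->
  \sum_(u <- shr a b) li_word u c = conv (li_word a) (li_word b) c.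
Proof.
elim: a b c => [|u1 a IHa] b c; first by rewrite shr_nil big_seq1 conv_delta.
elim: b c => [|u2 b IHb] c ha hb.
  by rewrite shr_nilr big_seq1 convC conv_delta.
rewrite shr_cons big_cat !big_map /= -!mulr_sumr -mulrDr.
have e1 : \sum_(u <- shr a (u2 :: b)) (if u1 then \sum_(j < c) li_word u j else li_word u c)
   = conv (fun i => i%:R * li_word (u1 :: a) i) (li_word (u2 :: b)) c.
  rewrite (conv_ext c (fun i => li_word_deriv i ha) (frefl _)).
  have ha' := last_true_behead ha.
  case: (u1) => /=; last by rewrite IHa.
  by rewrite exchange_big conv_prefix /=; apply: eq_bigr => d _; rewrite IHa.
have e2 : \sum_(u <- shr (u1 :: a) b) (if u2 then \sum_(j < c) li_word u j else li_word u c)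
   = conv (li_word (u1 :: a)) (fun i => i%:R * li_word (u2 :: b) i) c.
  rewrite (conv_ext c (frefl _) (fun i => li_word_deriv i hb)).
  have hb' := last_true_behead hb.
  case: (u2) => /=; last by rewrite IHb.
  rewrite exchange_big convC conv_prefix /=; apply: eq_bigr => d _.
  by rewrite IHb // convC.
(* At [c = 0] the factor cannot be cancelled, but both sides vanish because the inverse of 0 is
   0. *)
rewrite e1 e2 -conv_deriv; case: (c) => [|c']; last by rewrite mulKf // pnatr_eq0.
by rewrite invr0 mul0r /conv big_ord_recl big_ord0 /= invr0 !mul0r addr0.
Qed.

Lemma nil_in_shr a b : [::] \in shr a b -> a = [::].
Proof.
case: a b => // u1 a [|u2 b]; first by rewrite shr_nilr inE.
by rewrite shr_cons mem_cat => /orP[] /mapP[].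
Qed.

Lemma shr_sym a b u : u \in shr a b -> u \in shr b a.
Proof.
elim: a b u => [|u1 a IHa] b u; first by rewrite shr_nilr shr_nil.
elim: b u => [|u2 b IHb] u; first by rewrite shr_nilr shr_nil.
rewrite !shr_cons !mem_cat => /orP[] /mapP[v hv ->].
  by rewrite orbC map_f // IHa.
by rewrite map_f // IHb.
Qed.

Lemma last_shr a b u : last true a -> last true b -> u \in shr a b -> last true u.
Proof.
elim: a b u => [|u1 a IHa] b u; first by rewrite shr_nil inE => _ h /eqP ->.
elim: b u => [|u2 b IHb] u ha hb; first by rewrite shr_nilr inE => /eqP ->.
rewrite shr_cons mem_cat => /orP[] /mapP[v hv ->].
  have := IHa _ _ (last_true_behead ha) hb hv.
  by case: v hv => // /shr_sym/nil_in_shr.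
have := IHb _ ha (last_true_behead hb) hv.
by case: v hv => // /nil_in_shr.
Qed.

(* coefficient of [x ^ a] in [Li_k(x)], for the index [k = rev ks] *)
Definition li_idx (ks : seq nat) (a : nat) : rat :=
  if ks is k :: ks' then a%:R ^- k * Zrev ks' a else (a == 0%N)%:R.

Lemma sum_li_idx ks M : all (leq 1) ks -> (0 < M)%N -> \sum_(a < M) li_idx ks a = Zrev ks M.
Proof.
case: ks => [|k ks] /= h; case: M => // M _.
  by rewrite big_ord_recl big1 ?addr0.
case/andP: h => k0 _; rewrite big_ord_recl big_add1 /= big_mkord.
by rewrite expr0n gtn_eqF // invr0 mul0r add0r.
Qed.

Lemma li_word_idx ks a : all (leq 1) ks -> li_word (rev (zw (rev ks))) a = li_idx ks a.
Proof.
elim: ks a => [//|k ks IH] a /= /andP[k0 hk].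
rewrite rev_cons /zw map_rcons flatten_rcons rev_cat -/(zw (rev ks)) /zk rev_cons.
rewrite rev_nseq cat_rcons.
have e j b : li_word (nseq j lx ++ ly :: rev (zw (rev ks))) b =
    b%:R ^- j.+1 * \sum_(i < b) li_idx ks i.
  elim: j => [|j IHj] /=; last by rewrite IHj mulrA -invfM -exprS.
  by rewrite expr1; under eq_bigr do rewrite IH //.
rewrite e prednK //; case: a => [|a]; last by rewrite sum_li_idx.
by rewrite expr0n gtn_eqF // invr0 !mul0r.
Qed.

Lemma ZMw_li_word M u : (0 < M)%N -> head true u -> ZMw M u = \sum_(a < M) li_word (rev u) a.
Proof.
move=> M0 hu; rewrite /ZMw wdec2_eq0 hu /Zidx -sum_li_idx // ?all_rev ?wdec_gt0 //.
apply: eq_bigr => a _; rewrite -li_word_idx ?all_rev ?wdec_gt0 // revK.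
by rewrite {2}(wdecK u); move: hu; rewrite -wdec2_eq0 => /eqP ->.
Qed.

Lemma head_true_zw ks : head true (zw ks).
Proof. by case: ks. Qed.

Lemma last_true_rev u : last true (rev u) = head true u.
Proof. by case: u => // b u; rewrite rev_cons last_rcons. Qed.

Lemma ZM_Hsh_words M c u v : (0 < M)%N -> head true u -> head true v ->
  ZM M (Hsh (Hword u) (Hscale c (Hword v))) =
  c * \sum_(a < M) conv (li_word (rev u)) (li_word (rev v)) a.
Proof.
move=> M0 hu hv; rewrite /Hsh /= cats0 /ZM big_map /= mulr1 mul1r -mulr_sumr.
congr (_ * _); rewrite /shw big_map big_seq.
under [RHS]eq_bigr do rewrite -sum_li_word_shr ?last_true_rev // big_seq.
rewrite exchange_big /=; apply: eq_bigr => w hw.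
rewrite ZMw_li_word ?revK // -last_true_rev revK.
by apply: last_shr hw; rewrite last_true_rev.
Qed.

Lemma Hsh_catr p q r : Hsh [:: p] (q ++ r) = Hsh [:: p] q ++ Hsh [:: p] r.
Proof. by rewrite /Hsh /= !cats0 map_cat flatten_cat. Qed.

Lemma ZM_Hsh_flatten M p (I : Type) (r : seq I) (F : I -> Hel) :
  ZM M (Hsh [:: p] (flatten [seq F i | i <- r])) = \sum_(i <- r) ZM M (Hsh [:: p] (F i)).
Proof.
elim: r => [|i r IH]; first by rewrite big_nil /= /ZM big_nil.
by rewrite /= Hsh_catr ZM_cat big_cons IH.
Qed.

Lemma compsS m n :
  comps m.+1 n = flatten [seq map (cons j) (comps m (n - j)) | j <- iota 0 n.+1].
Proof. by []. Qed.

Lemma size_comps m n l : l \in comps m n -> size l = m.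
Proof.
elim: m n l => [|m IH] n l; first by rewrite /=; case: ifP => // _; rewrite inE => /eqP ->.
by rewrite compsS => /flatten_mapP[j _ /mapP[l' /IH <- ->]].
Qed.

Lemma addidx_gt0 ks l : all (leq 1) ks -> all (leq 1) (addidx ks l).
Proof.
rewrite /addidx; elim: ks l => [|k ks IH] [|j l] //= /andP[k0 /IH ->].
by rewrite addn_gt0 k0.
Qed.

Lemma ZM_phiw M n ks : (0 < M)%N -> all (leq 1) ks ->
  ZM M (phiw n ks) =
  \sum_(i < (size ks).+1) (-1) ^+ sumn (drop i ks) *
    \sum_(l <- comps (size ks - i) n) (bidx (drop i ks) l)%:R *
       \sum_(c < M) conv (li_idx (rev (take i ks))) (li_idx (addidx (drop i ks) l)) c.
Proof.
move=> M0 hk; rewrite /phiw ZM_flatten -[iota 0 _]/(index_iota 0 (size ks).+1).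
rewrite big_mkord; apply: eq_bigr => i _; rewrite ZM_scale ZM_Hsh_flatten; congr (_ * _).
apply: eq_bigr => l _; rewrite ZM_Hsh_words ?head_true_zw //; congr (_ * _).
have hkr : all (leq 1) (rev (take i ks)).
  by rewrite all_rev; apply/allP => x /mem_take; apply/allP.
have hka : all (leq 1) (addidx (drop i ks) l).
  by apply: addidx_gt0; apply/allP => x /mem_drop; apply/allP.
apply: eq_bigr => c _; apply: conv_ext => a; first by rewrite -li_word_idx // revK.
by rewrite -li_word_idx.
Qed.

Lemma inH1_phihat n p : inH1 (phihat n p).
Proof.
apply: inH1_all; apply/allP => a /flatten_mapP[b _ /mapP[c + ->]] /=.
move=> /flatten_mapP[i _ /mapP[d + ->]] /=.
rewrite /Hsh /= cats0 => /flatten_mapP[e /flatten_mapP[l _]] /=.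
rewrite inE => /eqP -> /= /mapP[u /mapP[v hv ->] ->] /=.
rewrite -last_true_rev revK; apply: last_shr hv; rewrite last_true_rev head_true_zw //.
Qed.

(** * Partial fractions for laminar families *)

(* Indices are reversed, so that the sum of the whole list [ms] comes first. *)
Fixpoint chain (R : nzRingType) (F : nat -> R -> R) (ks : seq nat) (ms : seq R) : R :=
  match ks, ms with
  | k :: ks', m :: ms' => F k (\sum_(x <- ms) x) * chain F ks' ms'
  | _, _ => 1
  end.

Definition negpow (R : unitRingType) (k : nat) (x : R) : R := x ^- k.

Section PartialFractions.
Variable V : finType.
Implicit Types (F : seq {set V}) (U A D : {set V}) (r u v : V).

Definition laminar F := forall D D', D \in F -> D' \in F ->
  [\/ D \subset D', D' \subset D | [disjoint D & D']].

Definition separating F (S : {set V}) := forall v v', v \in S -> v' \in S ->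
  v != v' -> exists2 D, D \in F & (v \in D) != (v' \in D).

(** [F] is a list because repetition encodes exponents. The point [r] plays the root: it lies in no
    member, so separation from [r] makes [F] cover [U]. Essential positivity is what provides the
    separation. *)
Definition admissible F U r :=
  [/\ forall D, D \in F -> D \subset U /\ D != set0,
      laminar F, r \notin U & separating F (r |: U)].

Definition covered F v := has (fun D => v \in D) F.

Lemma admissible_covered F U r v : admissible F U r -> v \in U -> covered F v.
Proof.
case=> hF _ rU sep vU; have [|||D DF] := sep v r.
- by rewrite !inE vU orbT.
- by rewrite !inE eqxx.
- by apply: contraNneq rU => <-.
have /hF[/subsetP DU _] := DF.
rewrite [r \in D](negbTE _); last by apply: contra rU; apply: DU.
by rewrite eqbF_neg negbK => vD; apply/hasP; exists D.
Qed.

Definition maximals F : {set {set V}} :=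
  [set A in F | [forall D : {set V}, (D \in F) ==> (A \subset D) ==> (D == A)]].

Lemma mem_maximals F A : A \in maximals F -> A \in F.
Proof. by rewrite inE => /andP[]. Qed.

Lemma maximals_max F A D : A \in maximals F -> D \in F -> A \subset D -> D = A.
Proof.
by rewrite inE => /andP[_ /forallP/(_ D)/implyP h] /h /implyP h' /h' /eqP.
Qed.

Lemma maximals_sub F D : D \in F -> exists2 A, A \in maximals F & D \subset A.
Proof.
move=> DF; pose P (A : {set V}) := (A \in F) && (D \subset A).
have PD : P D by rewrite /P DF subxx.
case: (arg_maxnP (fun A : {set V} => #|A|) PD) => A /andP[AF DA] mx.
exists A => //; rewrite inE AF; apply/forallP => B; apply/implyP => BF.
apply/implyP => AB; rewrite eq_sym eqEcard AB /=.
by apply: mx; rewrite /P BF (subset_trans DA).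
Qed.

Lemma laminar_maximal_sub F A D v : laminar F -> A \in maximals F -> D \in F ->
  v \in A -> v \in D -> D \subset A.
Proof.
move=> lam mA DF vA vD; case: (lam A D (mem_maximals mA) DF) => // [AD|dj].
  by rewrite (maximals_max mA DF AD).
by have := disjointFr dj vA; rewrite vD.
Qed.

Lemma partition_maximals F U r : admissible F U r -> partition (maximals F) U.
Proof.
move=> adm; have [hF lam _ _] := adm; apply/and3P; split.
- apply/eqP/setP => v; apply/bigcupP/idP => [[A /mem_maximals/hF[/subsetP h _]]|vU].
    exact: h.
  have /hasP[D DF vD] := admissible_covered adm vU.
  by have [A mA /subsetP DA] := maximals_sub DF; exists A => //; apply: DA.
- apply/trivIsetP => A B mA mB; apply: contraR => /pred0Pn[v /andP[vA vB]].
  rewrite eqEsubset (laminar_maximal_sub lam mB (mem_maximals mA) vB vA).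
  by rewrite (laminar_maximal_sub lam mA (mem_maximals mB) vA vB).
- by apply/negP => /mem_maximals/hF[_]; rewrite eqxx.
Qed.

Lemma mem_rem_neq F A D : D \in F -> D != A -> D \in rem A F.
Proof.
move=> DF; case: (boolP (A \in F)) => AF; last by rewrite rem_id.
have := perm_mem (perm_to_rem AF) D; rewrite DF inE => /esym/orP[/eqP ->|//].
by rewrite eqxx.
Qed.

(* Two points uncovered by removing [A] would both lie in [A], so no member of [F]
   would separate them. *)
Lemma admissible_rem F U r A : admissible F U r -> A \in maximals F ->
  admissible (rem A F) U r \/
  exists2 u, u \in U & admissible (rem A F) (U :\ u) u.
Proof.
move=> adm mA; have [hF lam rU sep] := adm.
have sub D : D \in rem A F -> D \in F by apply: mem_rem.
have lam' : laminar (rem A F) by move=> D D' /sub h /sub; apply: lam.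
(* A remaining member containing [v] lies inside the maximal set [A], hence misses [v']. *)
have splitA v v' : v \in A -> v' \notin A -> covered (rem A F) v ->
    exists2 D, D \in rem A F & (v \in D) != (v' \in D).
  move=> vA v'A /hasP[D DF vD]; exists D => //; rewrite vD.
  rewrite [v' \in D](negbTE _) //; apply: contra v'A; apply/subsetP.
  exact: (laminar_maximal_sub lam mA (sub _ DF) vA vD).
have sep' v v' D : D \in F -> (v \in D) != (v' \in D) ->
    (v \in A -> covered (rem A F) v) -> (v' \in A -> covered (rem A F) v') ->
    exists2 D, D \in rem A F & (v \in D) != (v' \in D).
  move=> DF vv' cv cv'; case: (eqVneq D A) => [e|ne]; last first.
    by exists D => //; apply: mem_rem_neq.
  move: vv'; rewrite e; case: (boolP (v \in A)) (boolP (v' \in A)) => vA [] v'A //= _.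
    by apply: splitA => //; apply: cv.
  by have [D' ? ?] := splitA _ _ v'A vA (cv' v'A); exists D'; rewrite // eq_sym.
case: (boolP [forall v in U, covered (rem A F) v]) => [/forall_inP cov|].
  left; split=> // [D /sub /hF //|v v' vS v'S ne].
  have AU : {subset A <= U} by apply/subsetP; case: (hF A (mem_maximals mA)).
  have [D DF vv'] := sep v v' vS v'S ne.
  by apply: (sep' _ _ _ DF vv') => /AU; apply: cov.
rewrite negb_forall => /existsP[u]; rewrite negb_imply => /andP[uU ncu].
(* The uncovered point lies in no remaining member, so it takes over the role of [r]. *)
right; exists u => //.
have uA : u \in A.
  have /hasP[D DF uD] := admissible_covered adm uU.
  case: (eqVneq D A) => [<- //|ne]; case/hasP: ncu; exists D => //.
  exact: mem_rem_neq.
(* If [A] separates [v] from [u], then [v] is outside [A] and a member covering [v] survives; any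
   other separating member contains [v] itself. *)
have cov v : v \in U -> v != u -> covered (rem A F) v.
  move=> vU vu; have [|||D DF uv] := sep v u; rewrite ?inE ?uU ?vU ?orbT //.
  case: (eqVneq D A) => [e|ne]; last first.
    have DF' := mem_rem_neq DF ne; apply/hasP; exists D => //.
    have nuD : u \notin D by apply: contra ncu => uD; apply/hasP; exists D.
    by move: uv; rewrite (negbTE nuD) eqbF_neg negbK.
  have /hasP[D' DF' vD'] := admissible_covered adm vU.
  apply/hasP; exists D' => //; apply: mem_rem_neq => //.
  by move: uv; rewrite e uA; apply: contraNneq => <-; rewrite vD'.
split=> // [D DF'| |v v'].
- have [DU D0] := hF _ (sub _ DF'); split => //; apply/subsetD1P; split => //.
  by apply: contra ncu => uD; apply/hasP; exists D.
- by rewrite !inE eqxx.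
rewrite setD1K // => vU v'U ne.
case: (eqVneq v u) => [vu|vu].
  have /hasP[D DF vD] : covered (rem A F) v' by apply: cov; rewrite // -vu eq_sym.
  exists D => //; rewrite vD vu eqb_id; apply: contra ncu => uD.
  by apply/hasP; exists D.
case: (eqVneq v' u) => [v'u|v'u].
  have /hasP[D DF vD] : covered (rem A F) v by apply: cov.
  exists D => //; rewrite vD v'u eq_sym eqb_id; apply: contra ncu => uD.
  by apply/hasP; exists D.
have [|||D DF vv'] := sep v v'; rewrite ?inE ?vU ?v'U ?orbT //.
by apply: (sep' _ _ _ DF vv') => _; apply: cov.
Qed.

(** A linear tree with its root outside [U]: [x.2] lists the vertices outwards from the root, [x.1]
    the exponent of the edge leading to each. *)
Definition is_chain U (x : seq nat * seq V) :=
  [&& all (leq 1) x.1, size x.1 == size x.2, uniq x.2 & [set v in x.2] == U].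

Lemma sum_chain (Z : nmodType) U (m : V -> Z) x : is_chain U x ->
  \sum_(v <- x.2) m v = \sum_(v in U) m v.
Proof.
move=> /and4P[_ _ ux /eqP <-]; rewrite big_uniq //=.
by apply: eq_bigl => v; rewrite inE.
Qed.

Definition unit_sums (R : unitRingType) U (m : V -> R) :=
  forall A, A \subset U -> A != set0 -> \sum_(v in A) m v \is a GRing.unit.

(* Iterates [\prod_(D <- F) 1 / s_D = 1 / s_U * \sum_A \prod_(D <- F - A) 1 / s_D],
   with [A] ranging over the maximal members of [F]: these partition [U], so
   [s_U = \sum_A s_A]. *)
Lemma partial_fractions F U r : admissible F U r ->
  exists2 L : seq (seq nat * seq V), all (is_chain U) L &
    forall (R : comUnitRingType) (m : V -> R), unit_sums U m ->
      \prod_(D <- F) (\sum_(v in D) m v)^-1 =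
      \sum_(x <- L) chain (@negpow R) x.1 (map m x.2).
Proof.
elim: {F}(size F) {-2}F (erefl (size F)) U r => [|n IHn] F sF U r adm.
  have F0 : F = [::] by apply/nilP; rewrite /nilp sF.
  exists [:: ([::], [::])] => [|R m _]; last first.
    by rewrite F0 big_nil big_seq1.
  rewrite /= /is_chain /= andbT; apply/eqP/setP => v; rewrite !inE.
  by apply/esym/negP => /(admissible_covered adm); rewrite F0.
have [hF lam rU sep] := adm.
have U0 : U != set0.
  case: F sF hF {adm lam sep} => // D F _ /(_ D (mem_head _ _))[DU].
  by apply: contraNneq => U0; rewrite -subset0 -U0.
(* Stated for every [A], with an arbitrary list outside [maximals F], so that finite choice
   applies. *)
have step A : exists LA : seq (seq nat * seq V), A \in maximals F ->
    all (is_chain U) LA /\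
    forall (R : comUnitRingType) (m : V -> R), unit_sums U m ->
      (\sum_(v in U) m v)^-1 * \prod_(D <- rem A F) (\sum_(v in D) m v)^-1 =
      \sum_(x <- LA) chain (@negpow R) x.1 (map m x.2).
  case: (boolP (A \in maximals F)) => [mA|_]; last by exists [::].
  have sF' : size (rem A F) = n by rewrite size_rem ?sF // mem_maximals.
  have [adm'|[u uU adm']] := admissible_rem adm mA.
    have [L' /allP hL' eL'] := IHn _ sF' _ _ adm'.
    (* With [U] unchanged, each chain already starts with a power of [1 / s_U], whose exponent goes
       up by one. *)
    pose bump (x : seq nat * seq V) := ((head 0%N x.1).+1 :: behead x.1, x.2).
    exists [seq bump x | x <- L'] => _.
    have ne x : x \in L' -> exists k ks v vs, x = (k :: ks, v :: vs).
      move=> /hL' /and4P[_ /eqP e _ /eqP eU]; case: x e eU => [[|k ks] [|v vs]] //=.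
        by move=> _ h; case/eqP: U0; rewrite -h; apply/setP => v; rewrite !inE.
      by move=> _ _; exists k, ks, v, vs.
    split.
      apply/allP => y /mapP[x xL ->]; have := hL' _ xL; rewrite /is_chain.
      by have [k [ks [v [vs ->]]]] := ne _ xL => /= /andP[/andP[_ ->]].
    move=> R m um; rewrite eL' // mulr_sumr big_map big_seq [RHS]big_seq.
    apply: eq_bigr => x xL; have [k [ks [v [vs ex]]]] := ne _ xL.
    rewrite ex /= mulrA; congr (_ * _); rewrite -map_cons big_map.
    have := sum_chain m (hL' _ xL); rewrite ex /= => ->.
    by rewrite /negpow -!exprVn exprS.
  (* With [u] split off, [1 / s_U] becomes a new first edge leading to [u]. *)
  have [L' /allP hL' eL'] := IHn _ sF' _ _ adm'.
  have hc x : x \in L' -> is_chain U (1%N :: x.1, u :: x.2).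
    move=> /hL' /and4P[h1 /eqP h2 h3 /eqP h4]; apply/and4P; split => //=.
    - by rewrite h2.
    - rewrite h3 andbT; have := setD11 u U.
      by rewrite -h4 inE => ->.
    - apply/eqP/setP => v; rewrite !inE; move/setP/(_ v): h4; rewrite !inE => ->.
      by case: eqP => [->|].
  exists [seq (1%N :: x.1, u :: x.2) | x <- L'] => _; split.
    by apply/allP => y /mapP[x xL ->]; apply: hc.
  move=> R m um; rewrite eL' => [|B BU]; last first.
    by apply: um; apply: subset_trans BU (subD1set _ _).
  rewrite mulr_sumr big_map big_seq [RHS]big_seq; apply: eq_bigr => x xL /=.
  congr (_ * _); rewrite -map_cons big_map.
  by rewrite (sum_chain m (hc _ xL)) /negpow expr1.
have [L hL] := fin_all_exists step.
exists (flatten [seq L A | A <- enum (maximals F)]).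
  apply/allP => x /flatten_mapP[A]; rewrite mem_enum => /hL[/allP h _] /h //.
move=> R m um.
rewrite big_flatten big_map big_enum /=.
transitivity ((\sum_(v in U) m v)^-1 *
    \sum_(A in maximals F) \prod_(D <- rem A F) (\sum_(v in D) m v)^-1); last first.
  by rewrite mulr_sumr; apply: eq_bigr => A mA; have [_ ->] := hL A mA.
have uU : \sum_(v in U) m v \is a GRing.unit by apply: um.
apply: (mulrI uU); rewrite mulVKr // (set_partition_big _ (partition_maximals adm)) /=.
rewrite mulr_suml; apply: eq_bigr => A mA.
have AF := mem_maximals mA; have [AU A0] := hF A AF.
by rewrite (perm_big _ (perm_to_rem AF)) big_cons mulVKr // um.
Qed.

End PartialFractions.

(** * Linear trees *)

Lemma sum_triangle (Z : nmodType) (f : nat -> nat -> Z) M :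
  \sum_(a < M) \sum_(b < M - a) f a b =
  \sum_(c < M) \sum_(a < c.+1) f a (c - a)%N.
Proof.
elim: M => [|M IH]; first by rewrite !big_ord0.
rewrite [RHS]big_ord_recr -IH /= [X in _ = X + _](_ : _ =
  \sum_(a < M.+1) \sum_(b < M - a) f a b); last first.
  by rewrite [RHS]big_ord_recr /= subnn big_ord0 addr0.
rewrite -big_split /=; apply: eq_bigr => a _.
by rewrite subSn -1?ltnS // big_ord_recr.
Qed.

Fixpoint pcomps (r M : nat) : seq (seq nat) :=
  match r with
  | 0 => if M == 0%N then [:: [::]] else [::]
  | r'.+1 => flatten [seq map (cons j) (pcomps r' (M - j)) | j <- iota 1 M]
  end.

Lemma mem_pcomps r M ms :
  (ms \in pcomps r M) = [&& size ms == r, all (leq 1) ms & sumn ms == M].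
Proof.
elim: r M ms => [|r IH] M ms /=.
  case: ms => [|m ms]; last by case: ifP.
  by rewrite /= eq_sym; case: ifP.
apply/flatten_mapP/idP => [[j + /mapP[ms']]|].
  rewrite mem_iota IH => jM /and3P[/eqP <- h2 /eqP h3] -> /=.
  by rewrite eqxx h2 andbT; apply/andP; split; lia.
case: ms => [//|m ms] /= /and3P[/eqP[sz] /andP[m0 h] /eqP e]; exists m.
  by rewrite mem_iota; lia.
by rewrite map_f // IH sz eqxx h /=; apply/eqP; lia.
Qed.

Lemma uniq_pcomps r M : uniq (pcomps r M).
Proof.
elim: r M => [|r IH] M /=; first by case: ifP.
elim: (iota 1 M) (iota_uniq 1 M) => [//|j s IHs] /= /andP[js us].
rewrite cat_uniq IHs // map_inj_uniq ?IH /= => [|? ? [] //]; rewrite andbT.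
apply/hasPn => _ /flatten_mapP[i si /mapP[x _ ->]].
by apply/negP => /mapP[y _ [e]]; rewrite -e si in js.
Qed.


Lemma sum_pcomps_rev (Z : nmodType) r M (G : seq nat -> Z) :
  \sum_(ms <- pcomps r M) G (rev ms) = \sum_(ms <- pcomps r M) G ms.
Proof.
rewrite -(big_map rev predT); apply: perm_big; apply: uniq_perm => [||ms].
- by rewrite map_inj_uniq ?uniq_pcomps //; apply: can_inj revK.
- exact: uniq_pcomps.
apply/mapP/idP => [[ms' + ->]|h].
  by rewrite !mem_pcomps size_rev all_rev sumn_rev.
exists (rev ms); last by rewrite revK.
by move: h; rewrite !mem_pcomps size_rev all_rev sumn_rev.
Qed.

Lemma sum_pcompsS (Z : nmodType) r M (G : seq nat -> Z) :
  \sum_(ms <- pcomps r.+1 M) G ms =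
  \sum_(b < M) \sum_(ms <- pcomps r b) G ((M - b)%N :: ms).
Proof.
have -> : pcomps r.+1 M =
    flatten [seq map (cons j) (pcomps r (M - j)) | j <- index_iota 1 M.+1].
  by rewrite /= /index_iota subn1.
rewrite big_flatten big_map big_add1 /= big_mkord (reindex_inj rev_ord_inj) /=.
apply: eq_bigr => b _; rewrite big_map.
have -> : (M - b.+1).+1 = (M - b)%N by have := ltn_ord b; lia.
by have -> : (M - (M - b) = b)%N by have := ltn_ord b; lia.
Qed.

Lemma sum_triangle_rev (Z : nmodType) (f : nat -> nat -> Z) M :
  \sum_(b < M) \sum_(a < b.+1) f b a =
  \sum_(b < M.+1) \sum_(a < b) f (M - b + a)%N a.
Proof.
rewrite [RHS]big_ord_recl /= big_ord0 add0r.
transitivity (\sum_(a < M) \sum_(b < M - a) f (a + b)%N a).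
  rewrite (sum_triangle (fun a b => f (a + b)%N a)).
  by apply: eq_bigr => b _; apply: eq_bigr => a _; rewrite subnKC // -ltnS.
transitivity (\sum_(a < M) \sum_(b < M - a) f (M - b.+1)%N a).
  apply: eq_bigr => a _; rewrite (reindex_inj rev_ord_inj) /=.
  apply: eq_bigr => b _; congr f.
  by have := ltn_ord a; have := ltn_ord b; lia.
rewrite (sum_triangle (fun a b => f (M - b.+1)%N a)).
apply: eq_bigr => b _; apply: eq_bigr => a _; congr f.
have := ltn_ord a; have := ltn_ord b; rewrite -[bump 0 b]/b.+1; lia.
Qed.

Lemma sum_pcomps_cat (Z : nmodType) p q M (G : seq nat -> Z) :
  \sum_(ms <- pcomps (p + q) M) G ms =
  \sum_(a < M.+1) \sum_(A <- pcomps p a) \sum_(B <- pcomps q (M - a)%N) G (A ++ B).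
Proof.
elim: p M G => [|p IH] M G.
  rewrite big_ord_recl /= big_seq1 subn0 [X in _ = _ + X]big1 ?addr0 // => a _.
  by rewrite big_nil.
rewrite addSn sum_pcompsS.
under eq_bigr do rewrite IH.
rewrite (sum_triangle_rev (fun b a => \sum_(A <- pcomps p a)
  \sum_(B <- pcomps q (b - a)%N) G ((M - b)%N :: A ++ B))).
apply: eq_bigr => b _; rewrite sum_pcompsS; apply: eq_bigr => a _.
apply: eq_bigr => A _; have -> : (M - b + a - a = M - b)%N by lia.
by have -> : (M - (M - b + a) = b - a)%N by have := ltn_ord a; have := ltn_ord b; lia.
Qed.

(** The bounds on [a] and [b] say exactly that the entry between the two parts is positive. *)
Lemma sum_pcomps_split (Z : nmodType) p q M (G : seq nat -> Z) :
  \sum_(ms <- pcomps (p + q.+1) M) G ms =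
  \sum_(a < M) \sum_(b < M - a) \sum_(A <- pcomps p a) \sum_(B <- pcomps q b)
     G (A ++ (M - a - b)%N :: B).
Proof.
rewrite sum_pcomps_cat big_ord_recr /= subnn.
rewrite [X in _ + X]big1 ?addr0 => [|A _]; last by rewrite big_nil.
apply: eq_bigr => a _; rewrite [RHS]exchange_big /=; apply: eq_bigr => A _.
exact: sum_pcompsS.
Qed.


(** The tail sums of a composition are the strictly decreasing summation indices of the harmonic
    sum, the largest being the total [b]. *)
Lemma sum_chain_li_idx (R : unitRingType) (f : {rmorphism rat -> R}) ks b : all (leq 1) ks ->
  \sum_(B <- pcomps (size ks) b) chain (@negpow R) ks (map (fun j => j%:R) B) =
  f (li_idx ks b).
Proof.
elim: ks b => [|k ks IH] b /=.
  by case: b => [|b] _; rewrite ?big_seq1 ?big_nil /= ?rmorph1 ?rmorph0.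
case/andP=> k0 hk; rewrite sum_pcompsS.
have e c B : (c < b)%N -> B \in pcomps (size ks) c ->
    chain (@negpow R) (k :: ks) (map (fun j => j%:R) ((b - c)%N :: B)) =
    f (b%:R ^- k) * chain (@negpow R) ks (map (fun j => j%:R) B).
  move=> cb; rewrite mem_pcomps => /and3P[_ _ /eqP sB] /=; congr (_ * _).
  rewrite -map_cons big_map -natr_sum -sumnE /= sB subnK 1?ltnW //.
  by rewrite /negpow fmorphV rmorphXn rmorph_nat.
transitivity (\sum_(c < b) f (b%:R ^- k) * f (li_idx ks c)).
  apply: eq_bigr => c _; rewrite -IH // mulr_sumr big_seq [RHS]big_seq.
  by apply: eq_bigr => B hB; apply: e.
rewrite -mulr_sumr -rmorph_sum -rmorphM; congr (f _).
case: b {e} => [|b]; last by rewrite sum_li_idx.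
by rewrite expr0n gtn_eqF // invr0 !mul0r.
Qed.

Lemma sum_compsS (Z : nmodType) m j (G : seq nat -> Z) :
  \sum_(l <- comps m.+1 j) G l = \sum_(a < j.+1) \sum_(l <- comps m (j - a)) G (nat_of_ord a :: l).
Proof.
rewrite compsS big_flatten big_map -[iota 0 j.+1]/(index_iota 0 j.+1) big_mkord.
by apply: eq_bigr => a _; rewrite big_map.
Qed.

(* The factors of a chain at the edges between the root and a vertex, in terms of
   the total [T] of the shifted variables. *)
Fixpoint front (R : unitRingType) (T : R) (ks : seq nat) (ms : seq R) : R :=
  match ks, ms with
  | k :: ks', m :: ms' => negpow k (T - m) * front (T - m) ks' ms'
  | _, _ => 1
  end.

(** A tail sum that includes [y] is [T] minus a prefix sum of [A], so [y] enters only through the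
    total [T] and the product splits. [behead] drops the variable of the root. *)
Lemma chain_split (R : unitRingType) (T y : R) ks1 ks2 A B : size ks1 = size A ->
  T = \sum_(a <- A) a + (y + \sum_(b <- B) b) ->
  chain (@negpow R) (ks1 ++ ks2) (behead (A ++ y :: B)) =
  front T ks1 A * chain (@negpow R) ks2 B.
Proof.
elim: ks1 A T => [|k ks1 IH] [|a A] T //= => [_ _|[sA] eT]; first by rewrite mul1r.
have eTa : T - a = \sum_(x <- A) x + (y + \sum_(b <- B) b).
  by rewrite eT big_cons -(addrA a) [LHS]addrC addKr.
rewrite -mulrA -(IH _ _ sA eTa).
have -> : T - a = \sum_(x <- A ++ y :: B) x by rewrite eTa big_cat big_cons.
by case: (A).
Qed.

Lemma chain_rcons (R : unitRingType) (T a : R) ks ms k : size ks = size ms ->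
  chain (fun k c => negpow k (T - c)) (rcons ks k) (rcons ms a) =
  chain (fun k c => negpow k (T - a - c)) ks ms * negpow k (T - a).
Proof.
elim: ks ms => [|k' ks IH] [|m ms] //= => [_|[sz]].
  by rewrite big_seq1 mul1r mulr1.
rewrite IH // mulrA -rcons_cons -cats1 big_cat big_seq1 /=.
by rewrite opprD addrA addrAC.
Qed.

(** Prefix sums are tail sums seen from the other end: the edges between the two roots form a linear
    tree with reversed index. *)
Lemma front_rev (R : comUnitRingType) (T : R) ks ms : size ks = size ms ->
  front T ks ms = chain (fun k c => negpow k (T - c)) (rev ks) (rev ms).
Proof.
elim: ks ms T => [|k ks IH] [|m ms] T //= [sz].
by rewrite !rev_cons chain_rcons ?size_rev // -IH // mulrC.
Qed.

Lemma bidx_cons k ks a l : bidx (k :: ks) (a :: l) = ('C(k + a - 1, a) * bidx ks l)%N.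
Proof. exact: big_cons. Qed.

Section Truncation.
Variables (R : comUnitAlgType rat) (T : R) (n : nat).
Hypothesis Tn : T ^+ n.+1 = 0.

(** The coefficient of [T^l] in [(T - c)^-k], which is the source of the signs and binomials of the
    symmetrization map. At [k = 0] the truncated subtraction leaves the constant 1. *)
Definition negpow_coef (k c l : nat) : rat :=
  (-1) ^+ k * 'C(k + l - 1, l)%:R * c%:R ^- (k + l).

Definition negpow_series k c : R := \sum_(l < n.+1) (negpow_coef k c l)%:A * T ^+ l.

Lemma negpow_series0 c : negpow_series 0 c = 1.
Proof.
rewrite /negpow_series big_ord_recl big1 => [|l _].
  by rewrite /negpow_coef !expr0 bin0 !mulr1 addr0 ?invr1 scale1r.
by rewrite /negpow_coef add0n lift0 subn1 bin_small // mulr0 mul0r scale0r mul0r.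
Qed.

(** On coefficients this is Pascal's rule; [Tn] kills the term beyond the truncation. *)
Lemma negpow_seriesS k c : (0 < c)%N ->
  (T - c%:R) * negpow_series k.+1 c = negpow_series k c.
Proof.
move=> c0; have cn0 : c%:R != 0 :> rat by rewrite pnatr_eq0 -lt0n.
have ec : c%:R = (c%:R : rat)%:A :> R by rewrite -[RHS]/(in_alg R _) rmorph_nat.
rewrite mulrBl {1 3}/negpow_series mulr_sumr [X in X - _]big_ord_recr /=.
rewrite mulrCA -exprS Tn mulr0 addr0 /negpow_series ec mulr_sumr.
rewrite [X in _ - X]big_ord_recl [RHS]big_ord_recl opprD addrCA; congr (_ + _).
  rewrite /= expr0 !mulr1 -scalerAl mul1r scalerA -scaleNr; congr (_ *: _).
  rewrite /negpow_coef !addn0 !bin0 !mulr1 exprS mulN1r exprS invfM.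
  by rewrite !mulNr mulrN opprK mulrCA mulVKf.
rewrite -sumrB; apply: eq_bigr => l _; rewrite mulrCA -exprS lift0 mulrA -mulrBl.
congr (_ * _); rewrite -scalerAl mul1r scalerA -scalerBl; congr (_ *: _).
rewrite /negpow_coef !addSn !addnS !subn1 /= binS natrD exprS.
rewrite [c%:R ^+ (k + l).+2]exprS invfM.
move: (c%:R ^- (k + l).+1) => x; set u := (-1) ^+ k.
by field.
Qed.

Lemma negpow_seriesE k c : (0 < c)%N -> (T - c%:R) ^+ k * negpow_series k c = 1.
Proof.
move=> c0; elim: k => [|k IH]; first by rewrite expr0 mul1r negpow_series0.
by rewrite exprSr -mulrA negpow_seriesS.
Qed.

Lemma unit_subC c : (0 < c)%N -> T - c%:R \is a GRing.unit.
Proof.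
move=> c0; apply/unitrPr; exists (negpow_series 1 c).
by rewrite -[X in X * _]expr1 negpow_seriesE.
Qed.

Lemma negpow_expand k c : (0 < c)%N -> negpow k (T - c%:R) = negpow_series k c.
Proof.
move=> c0; apply: (mulrI (unitrX k (unit_subC c0))).
by rewrite negpow_seriesE // mulrV // unitrX // unit_subC.
Qed.

Lemma mul_truncated (x y : nat -> rat) :
  (\sum_(a < n.+1) (x a)%:A * T ^+ a) * (\sum_(b < n.+1) (y b)%:A * T ^+ b) =
  \sum_(j < n.+1) (conv x y j)%:A * T ^+ j.
Proof.
transitivity (\sum_(a < n.+1) \sum_(b < n.+1 - a) (x a * y b)%:A * T ^+ (a + b)).
  rewrite mulr_suml; apply: eq_bigr => a _; rewrite mulr_sumr.
  rewrite (big_ord_widen n.+1 (fun b => (x a * y b)%:A * T ^+ (a + b))) ?leq_subr //.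
  rewrite [RHS]big_mkcond; apply: eq_bigr => b _.
  rewrite mulrACA -exprD -[X in X * _]scalerAl mul1r scalerA.
  case: ifP => // /negbT h; have -> : (a + b = n.+1 + (a + b - n.+1))%N by lia.
  by rewrite exprD Tn mul0r mulr0.
rewrite (sum_triangle (fun a b => (x a * y b)%:A * T ^+ (a + b))).
apply: eq_bigr => j _; rewrite /conv scaler_suml mulr_suml; apply: eq_bigr => a _.
by rewrite subnKC // -ltnS.
Qed.

Lemma chain_expand ks (A : seq nat) : size ks = size A -> all (leq 1) A ->
  chain (fun k c => negpow k (T - c)) ks (map (fun j => j%:R) A) =
  \sum_(j < n.+1) ((-1) ^+ sumn ks * \sum_(l <- comps (size ks) j)
     (bidx ks l)%:R *
     chain (@negpow rat) (addidx ks l) (map (fun j => j%:R) A))%:A * T ^+ j.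
Proof.
elim: ks A => [|k ks IH] [|m A] //= => [_ _|[sz] /andP[m0 hA]].
  rewrite big_ord_recl [X in _ = _ + X]big1 ?addr0 => [|j _]; last first.
    by rewrite /= big_nil mulr0 scale0r mul0r.
  by rewrite big_seq1 /= /bidx big_nil !mulr1 scale1r.
rewrite -map_cons big_map -natr_sum -sumnE negpow_expand /=; last by rewrite addn_gt0 m0.
rewrite IH // (mul_truncated (negpow_coef k (m + sumn A))
  (fun j => (-1) ^+ sumn ks * \sum_(l <- comps (size ks) j) (bidx ks l)%:R *
     chain (@negpow rat) (addidx ks l) (map (fun j => j%:R) A))).
apply: eq_bigr => j _; congr (_%:A * _).
rewrite /conv -[_ ++ _]/(comps (size ks).+1 j) sum_compsS mulr_sumr.
apply: eq_bigr => a _; rewrite !mulr_sumr; apply: eq_bigr => l _.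
rewrite /= bidx_cons natrM exprD /negpow_coef.
rewrite -map_cons big_map -natr_sum -sumnE /= /negpow.
move: (_ ^- _) => c; move: (chain _ _ _) => d; move: (bidx _ _) => e.
ring.
Qed.

End Truncation.

(* The value of a reversed chain after adding [x] to the [i]-th variable; the
   variable of the root, which comes first, does not enter. *)
Definition shifted_chain (R : unitRingType) (ks : seq nat) (x : R) (i : nat)
    (ms : seq nat) : R :=
  chain (@negpow R) ks
    (behead (map (fun j => j%:R) (take i ms) ++
             ((nth 0%N ms i)%:R + x) :: map (fun j => j%:R) (drop i.+1 ms))).

(** After the shift the variables have total [T], so [chain_split] separates the vertices before
    position [i] from those after it. The variable at [i] only forces the totals of the two sides to
    satisfy [a + b < M], which produces partial sums of a Cauchy product, hence of a shuffle
    product. *)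
Lemma sum_shifted_chain (R : comUnitAlgType rat) (T : R) (n : nat) (ks : seq nat)
    (M i : nat) :
  T ^+ n.+1 = 0 -> (i <= size ks)%N -> all (leq 1) ks ->
  \sum_(ms <- pcomps (size ks).+1 M) shifted_chain ks (T - M%:R) i ms =
  \sum_(j < n.+1) ((-1) ^+ sumn (take i ks) *
    \sum_(l <- comps i j) (bidx (rev (take i ks)) l)%:R *
      \sum_(c < M) conv (li_idx (drop i ks)) (li_idx (addidx (rev (take i ks)) l)) c)%:A * T ^+ j.
Proof.
move=> Tn ik hk.
have hk1 : all (leq 1) (rev (take i ks)).
  by rewrite all_rev; apply/allP => x /mem_take; apply/allP.
have hk2 : all (leq 1) (drop i ks) by apply/allP => x /mem_drop; apply/allP.
have s1 : size (take i ks) = i by rewrite size_takel.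
have s2 : size (drop i ks) = (size ks - i)%N by rewrite size_drop.
have -> : (size ks).+1 = (i + (size ks - i).+1)%N by rewrite addnS subnKC.
rewrite sum_pcomps_split.
have e a b A B : (a < M)%N -> (b < M - a)%N -> A \in pcomps i a ->
    B \in pcomps (size ks - i) b ->
    shifted_chain ks (T - M%:R) i (A ++ (M - a - b)%N :: B) =
    front T (take i ks) (map (fun j => j%:R) A) *
    chain (@negpow R) (drop i ks) (map (fun j => j%:R) B).
  move=> aM bM; rewrite !mem_pcomps => /and3P[/eqP sA _ /eqP eA] /and3P[/eqP sB _ /eqP eB].
  rewrite /shifted_chain -{1}sA take_size_cat // nth_cat sA ltnn subnn /=.
  have -> : drop i.+1 (A ++ (M - a - b)%N :: B) = B.
    by rewrite -cat_rcons drop_size_cat // size_rcons sA.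
  rewrite -{1}(cat_take_drop i ks); apply: chain_split.
    by rewrite size_map s1 sA.
  rewrite !big_map -!natr_sum -!sumnE eA eB.
  have -> : M = (a + (M - a - b + b))%N by lia.
  rewrite [X in T - X]natrD natrD.
  have -> : (a + (M - a - b + b) - a - b = M - a - b)%N by lia.
  ring.
have front_sum a : \sum_(A <- pcomps i a) front T (take i ks) (map (fun j => j%:R) A) =
    \sum_(j < n.+1) ((-1) ^+ sumn (take i ks) *
       \sum_(l <- comps i j) (bidx (rev (take i ks)) l)%:R *
          li_idx (addidx (rev (take i ks)) l) a)%:A * T ^+ j.
  transitivity (\sum_(A <- pcomps i a) chain (fun k c => negpow k (T - c))
      (rev (take i ks)) (map (fun j => j%:R) A)).
    rewrite -[RHS]sum_pcomps_rev big_seq [RHS]big_seq; apply: eq_bigr => A.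
    rewrite mem_pcomps => /and3P[/eqP sA _ _].
    by rewrite front_rev ?size_map ?s1 // map_rev.
  transitivity (\sum_(A <- pcomps i a) \sum_(j < n.+1) ((-1) ^+ sumn (take i ks) *
      \sum_(l <- comps i j) (bidx (rev (take i ks)) l)%:R *
     chain (@negpow rat) (addidx (rev (take i ks)) l) (map (fun j => j%:R) A))%:A * T ^+ j).
    rewrite big_seq [RHS]big_seq; apply: eq_bigr => A.
    rewrite mem_pcomps => /and3P[/eqP sA hA _].
    by rewrite (chain_expand Tn) ?size_rev ?s1 ?sA // sumn_rev.
  rewrite exchange_big; apply: eq_bigr => j _ /=.
  rewrite -mulr_suml -scaler_suml -mulr_sumr exchange_big /=.
  congr ((_ * _)%:A * _); rewrite big_seq [RHS]big_seq; apply: eq_bigr => l hl.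
  rewrite -mulr_sumr; congr (_ * _).
  have sl : size (addidx (rev (take i ks)) l) = i.
    by rewrite /addidx size_map size_zip size_rev s1 (size_comps hl) minnn.
  by have := sum_chain_li_idx idfun a (addidx_gt0 l hk1); rewrite sl.
transitivity (\sum_(a < M) \sum_(b < M - a)
   (\sum_(A <- pcomps i a) front T (take i ks) (map (fun j => j%:R) A)) *
   (li_idx (drop i ks) b)%:A : R).
  apply: eq_bigr => a _; apply: eq_bigr => b _.
  rewrite mulr_suml big_seq [RHS]big_seq; apply: eq_bigr => A hA.
  rewrite -[_%:A]/(in_alg R _) -sum_chain_li_idx // mulr_sumr s2 big_seq [RHS]big_seq.
  apply: eq_bigr => B hB.
  by apply: e.
rewrite (sum_triangle (fun a b =>
   (\sum_(A <- pcomps i a) front T (take i ks) (map (fun j => j%:R) A)) *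
   (li_idx (drop i ks) b)%:A)).
under eq_bigr do under eq_bigr do rewrite front_sum mulr_suml.
under eq_bigr do rewrite exchange_big.
rewrite exchange_big; apply: eq_bigr => j _ /=.
transitivity ((\sum_(c < M) \sum_(a < c.+1) ((-1) ^+ sumn (take i ks) *
       \sum_(l <- comps i j) (bidx (rev (take i ks)) l)%:R *
          li_idx (addidx (rev (take i ks)) l) a) * li_idx (drop i ks) (c - a)%N)%:A * T ^+ j).
  rewrite scaler_suml mulr_suml; apply: eq_bigr => c _.
  rewrite scaler_suml mulr_suml; apply: eq_bigr => a _.
  by rewrite mulrAC -[X in X * _]scalerAl mul1r scalerA.
congr (_%:A * _).
rewrite mulr_sumr; under [RHS]eq_bigr do rewrite !mulr_sumr.
rewrite [RHS]exchange_big; apply: eq_bigr => c _ /=.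
under [RHS]eq_bigr do rewrite convC !mulr_sumr.
rewrite [RHS]exchange_big; apply: eq_bigr => a _ /=.
rewrite mulr_sumr mulr_suml; apply: eq_bigr => l _.
by rewrite !mulrA.
Qed.

(** [theta] stands for the coefficient of [T^n]. Position [i] of the reversed index corresponds to
    cutting [rev ks] after [size ks - i] entries, hence the reversed summation. *)
Lemma chain_identity (R : comUnitAlgType rat) (T : R) (n : nat)
    (theta : {additive R -> rat}) (ks : seq nat) (M : nat) :
  T ^+ n.+1 = 0 ->
  (forall c j, (j <= n)%N -> theta (c%:A * T ^+ j) = c * (j == n)%:R) ->
  all (leq 1) ks -> (0 < M)%N ->
  theta (\sum_(i < (size ks).+1) \sum_(ms <- pcomps (size ks).+1 M)
           shifted_chain ks (T - M%:R) i ms) = ZM M (phiw n (rev ks)).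
Proof.
move=> Tn hth hk M0; rewrite ZM_phiw ?all_rev // size_rev (reindex_inj rev_ord_inj) /=.
rewrite raddf_sum; apply: eq_bigr => i _; rewrite (sum_shifted_chain _ Tn) //; last first.
  by rewrite subSS leq_subr.
rewrite raddf_sum big_ord_recr /= hth // eqxx mulr1 big1 ?add0r => [|j _]; last first.
  by rewrite hth ?(ltnW (ltn_ord j)) // ltn_eqF // mulr0.
have ik : (i <= size ks)%N by rewrite -ltnS.
have -> : drop i (rev ks) = rev (take (size ks - i) ks) by rewrite drop_rev.
have -> : rev (take i (rev ks)) = drop (size ks - i) ks by rewrite take_rev revK.
by rewrite sumn_rev subSS.
Qed.

Lemma sum_ffun_pcomps (V : finType) (Z : nmodType) (Vb : {set V}) (s : seq V)
    (M : nat) (G : seq nat -> Z) :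
  uniq s -> s =i Vb ->
  \sum_(m : {ffun V -> 'I_M.+1} |
     [forall v, (v \in Vb) == (0 < m v)%N] && ((\sum_(v in Vb) (m v : nat))%N == M))
     G [seq nat_of_ord (m v) | v <- s] =
  \sum_(ms <- pcomps (size s) M) G ms.
Proof.
move=> us es; rewrite -big_filter -(big_map (fun m : {ffun V -> 'I_M.+1} =>
  [seq nat_of_ord (m v) | v <- s]) predT); apply: perm_big; apply: uniq_perm.
- rewrite map_inj_in_uniq ?filter_uniq ?index_enum_uniq // => m m'.
  rewrite !mem_filter => /andP[/andP[/forallP h _] _] /andP[/andP[/forallP h' _] _].
  move=> /eq_in_map e; apply/ffunP => v; apply/val_inj => /=.
  case: (boolP (v \in Vb)) => vV; first by apply: e; rewrite es.
  have := h v; have := h' v; rewrite (negbTE vV) ![false == _]eq_sym !eqbF_neg -!leqNgt !leqn0.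
  by move=> /eqP -> /eqP ->.
- exact: uniq_pcomps.
move=> ms; rewrite mem_pcomps; apply/mapP/idP => [[m + ->]|/and3P[/eqP sz ps /eqP eM]].
  rewrite mem_filter => /andP[/andP[/forallP h /eqP e] _].
  rewrite size_map eqxx /= sumnE big_map big_uniq //=; apply/andP; split.
    apply/allP => x /mapP[v]; rewrite es => vV ->.
    by have /eqP := h v; rewrite vV.
  by rewrite -[X in _ == X]e; apply/eqP/eq_bigl => v; rewrite es.
have hb v : (nth 0%N ms (index v s) < M.+1)%N.
  rewrite ltnS -eM; case: (ltnP (index v s) (size ms)) => h; last by rewrite nth_default.
  by rewrite sumnE (big_rem _ (mem_nth 0%N h)) leq_addr.
(* For [v] not in [s] the index is past the end, and the default 0 of [nth] makes [m] vanish off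
   [Vb]. *)
pose m : {ffun V -> 'I_M.+1} := [ffun v => Ordinal (hb v)].
have em : ms = [seq nat_of_ord (m v) | v <- s].
  apply: (@eq_from_nth _ 0%N) => [|i]; rewrite ?size_map // sz => i_s.
  have x0 : V by case: (s) i_s.
  by rewrite (nth_map x0) // ffunE /= index_uniq.
exists m => //; rewrite mem_filter mem_index_enum andbT; apply/andP; split.
  apply/forallP => v; rewrite ffunE /=; case: (boolP (v \in Vb)) => vV.
    rewrite eq_sym eqb_id; apply: (allP ps); apply: mem_nth.
    by rewrite sz index_mem es.
  by rewrite nth_default // sz memNindex // es.
rewrite -[X in _ == X]eM em sumnE big_map big_uniq //=; apply/eqP.
by apply: eq_bigl => v; rewrite es.
Qed.

(** * Cuts of trees *)

Section TreeCuts.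
Variable V : finType.
Implicit Types (E : {set {set V}}) (e : {set V}).

(* Recolouring merges two classes per edge. With one edge fewer than a tree, at
   least two colours remain, which makes every edge of a tree a bridge. *)
Lemma edge_coloring E : exists c : V -> V,
  (forall a b, [set a; b] \in E -> c a = c b) /\
  (#|V| <= #|E| + #|[set c v | v : V]|)%N.
Proof.
elim: {E}#|E| {-2}E (erefl #|E|) => [|N IH] E cE.
  exists id; rewrite (cards0_eq cE); split => [a b|]; first by rewrite inE.
  by rewrite cards0 add0n card_imset.
have [e eE] : exists e, e \in E by apply/card_gt0P; rewrite cE.
have cE' : #|E :\ e| = N by move: (cardsD1 e E); rewrite eE cE => -[].
have [c [cc ci]] := IH _ cE'.
case: (boolP [exists a, exists b, e == [set a; b]]) => [|ne]; last first.
  exists c; split => [a b abE|]; last by apply: leq_trans ci _; rewrite cE' leq_add2r cE.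
  apply: cc; rewrite !inE abE andbT; apply: contraNneq ne => h.
  by apply/existsP; exists a; apply/existsP; exists b; rewrite h.
move=> /existsP[a /existsP[b /eqP ee]].
exists (fun v => if c v == c a then c b else c v); split => [p q pqE|].
  case: (eqVneq [set p; q] e) => [|pqe]; last by rewrite (cc p q) // !inE pqe.
  rewrite ee => h; have : p \in [set a; b] by rewrite -h !inE eqxx.
  have : q \in [set a; b] by rewrite -h !inE eqxx orbT.
  by rewrite !inE => /orP[] /eqP -> /orP[] /eqP ->; rewrite ?eqxx //; case: eqP.
apply: leq_trans ci _; rewrite cE' cE addSnnS leq_add2l.
apply: leq_trans (_ : _ <= #|c a |: [set (if c v == c a then c b else c v) | v : V]|)%N _.
  apply/subset_leq_card/subsetP => _ /imsetP[v _ ->]; rewrite !inE.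
  case: (eqVneq (c v) (c a)) => //= h; apply/imsetP; exists v => //.
  by rewrite (negbTE h).
by rewrite cardsU1; case: (_ \in _).
Qed.

Lemma const_connect (T : Type) E (f : V -> T) a b :
  (forall p q, [set p; q] \in E -> f p = f q) -> connect (adjE E) a b -> f a = f b.
Proof.
move=> h /connectP[s]; elim: s a => [|x s IH] a /=; first by move=> _ ->.
by case/andP=> /h -> /IH.
Qed.

(** A two-colouring that changes along [e] and along no other edge. It replaces paths: by
    [mem_tpath], lying on a path becomes a comparison of colours. *)
Definition is_cut E e (S : V -> bool) :=
  (forall a b, [set a; b] \in E -> [set a; b] != e -> S a = S b) /\
  (forall a b, [set a; b] = e -> S a != S b).

(** Without [e] the edges are too few to leave a single colour, whereas equal colours at the ends of
    [e] would make the colouring constant by connectedness. *)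
Lemma tree_cut E e : is_tree E -> e \in E -> exists S, is_cut E e S.
Proof.
case/and3P=> /forall_inP c2 /'forall_forallP con /eqP cV eE.
have [c [cc ci]] := edge_coloring (E :\ e).
have ci2 : (1 < #|[set c v | v : V]|)%N.
  by move: ci; rewrite -cV (cardsD1 e E) eE /= add1n -addn2 leq_add2l.
have /cards2P[x [y [xy ee]]] := c2 e eE.
have cE a b : [set a; b] \in E -> [set a; b] != e -> c a = c b.
  by move=> h ne; apply: cc; rewrite !inE ne.
have cxy : c x != c y.
  apply/eqP => h; move: ci2; rewrite ltnNge => /negP; apply.
  rewrite (_ : [set c v | v : V] = [set c x]) ?cards1 //.
  have fc p q : [set p; q] \in E -> c p = c q.
    move=> pq; case: (eqVneq [set p; q] e) => [|ne]; last exact: cE.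
    rewrite ee => he; have : p \in [set x; y] by rewrite -he !inE eqxx.
    have : q \in [set x; y] by rewrite -he !inE eqxx orbT.
    by rewrite !inE => /orP[] /eqP -> /orP[] /eqP ->.
  apply/setP => z; rewrite !inE; apply/imsetP/eqP => [[v _ ->]|->]; last by exists x.
  exact: const_connect fc (con v x).
exists (fun v => c v == c x); split => [a b h ne|a b h]; first by rewrite (cE a b).
have : x \in [set a; b] by rewrite h ee !inE eqxx.
have : y \in [set a; b] by rewrite h ee !inE eqxx orbT.
rewrite !inE => /orP[] /eqP ey /orP[] /eqP ex; move: cxy; rewrite ex ey ?eqxx //;
  by rewrite eq_sym => /negbTE ->.
Qed.

Lemma path_edges_cut E e S v s : is_cut E e S -> path (adjE E) v s ->
  e \notin [seq [set p.1; p.2] | p <- zip (v :: s) s] -> S v = S (last v s).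
Proof.
case=> cS _; elim: s v => [//|x s IH] v /= /andP[vx ps].
rewrite inE negb_or => /andP[ne /IH <- //]; apply: cS => //.
by rewrite eq_sym.
Qed.

Lemma path_edges_mem v s e : e \in [seq [set p.1; p.2] | p <- zip (v :: s) s] ->
  {subset e <= v :: s}.
Proof.
elim: s v => [//|x s IH] v /=; rewrite inE => /orP[/eqP ->|/IH h] u.
  by rewrite !inE => /orP[] ->; rewrite ?orbT.
by move=> /h h'; rewrite inE h' orbT.
Qed.

(** A path avoiding [e] keeps the colour, and a simple path crosses [e] at most once, since a second
    crossing would revisit an endpoint. *)
Lemma mem_tpath E e S v u : is_tree E -> e \in E -> is_cut E e S ->
  (e \in tpath E v u) = (S v != S u).
Proof.
case/and3P=> _ /'forall_forallP con _ eE cS; rewrite inE eE /=.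
apply/existsP/idP => [[n /existsP[s /and4P[ps /eqP <- us]]]|ne].
  move: ps us; elim: (tval s) v => [//|x t IH] v /= /andP[vx pt] /andP[vt ut].
  rewrite inE => /orP[/eqP ee|et].
    have -> : S (last x t) = S x.
      apply/esym/(path_edges_cut cS pt); apply: contra vt => /path_edges_mem; apply.
      by rewrite ee !inE eqxx.
    by case: cS => _; apply; rewrite ee.
  have /(_ _ _ vx) -> := cS.1; first exact: IH.
  by apply: contraNneq vt => h; apply: (path_edges_mem et); rewrite -h !inE eqxx.
have /connectP[s0 ps0 eu] := con v u; move: ne; rewrite eu.
case/shortenP: ps0 => s ps us _ ne.
have sz : (size s < #|V|)%N.
  by have := max_card (mem (v :: s)); rewrite (card_uniqP us).
exists (Ordinal sz); apply/existsP; exists (in_tuple s).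
rewrite /= ps eqxx /= -[_ && uniq s]/(uniq (v :: s)) us /=.
by apply: contraR ne => /(path_edges_cut cS ps) ->; rewrite eqxx.
Qed.

(** Two cuts leave one of their four regions empty. The ends of [e] agree under [S'] and those of
    [e'] under [S], so the disjunction is constant along every edge, and it holds at [x]. *)
Lemma cuts_nested E e e' S S' : is_tree E -> e \in E -> e' \in E -> e != e' ->
  is_cut E e S -> is_cut E e' S' ->
  exists s t, forall v, (S v == s) || (S' v == t).
Proof.
case/and3P=> /forall_inP c2 /'forall_forallP con _ eE e'E ne cS cS'.
have /cards2P[x [y [xy ee]]] := c2 e eE.
have /cards2P[a [b [ab ee']]] := c2 e' e'E.
exists (S a), (S' x).
have Se p : p \in e' -> S p = S a.
  have sab : S a = S b by apply: (cS.1); rewrite -ee' // eq_sym.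
  by rewrite ee' !inE => /orP[] /eqP ->.
have S'e p : p \in e -> S' p = S' x.
  have sxy : S' x = S' y by apply: (cS'.1); rewrite -ee.
  by rewrite ee !inE => /orP[] /eqP ->.
move=> v; have -> : (S v == S a) || (S' v == S' x) =
    ((S x == S a) || (S' x == S' x)).
  apply: (@const_connect _ E (fun w => (S w == S a) || (S' w == S' x))) (con v x).
  move=> p q pq /=.
  case: (eqVneq [set p; q] e) => [pe|npe].
    by rewrite !S'e ?eqxx ?orbT // -pe !inE eqxx ?orbT.
  case: (eqVneq [set p; q] e') => [pe|npe'].
    by rewrite !Se ?eqxx // -pe !inE eqxx ?orbT.
  by rewrite (cS.1 p q) // (cS'.1 p q).
by rewrite eqxx orbT.
Qed.

Definition beyond E (rt : V) (Vb : {set V}) e := [set u in Vb | e \in tpath E rt u].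

Lemma mem_beyond E (rt : V) (Vb : {set V}) e u :
  (u \in beyond E rt Vb e) = (u \in Vb) && (e \in tpath E rt u).
Proof. by rewrite [LHS]inE. Qed.

(** The root is not in the empty region of [cuts_nested], so three positions of that region remain:
    they give disjointness and the two inclusions. *)
Lemma laminar_beyond E rt Vb (F : seq {set V}) : is_tree E ->
  {subset F <= [set beyond E rt Vb e | e in E]} -> laminar F.
Proof.
move=> tE sF D D' /sF/imsetP[e eE ->] /sF/imsetP[e' e'E ->].
case: (eqVneq e e') => [->|ne]; first by constructor 1.
have [S cS] := tree_cut tE eE; have [S' cS'] := tree_cut tE e'E.
have [s [t st]] := cuts_nested tE eE e'E ne cS cS'.
have De u : (u \in beyond E rt Vb e) = (u \in Vb) && (S rt != S u).
  by rewrite mem_beyond (mem_tpath _ _ tE eE cS).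
have De' u : (u \in beyond E rt Vb e') = (u \in Vb) && (S' rt != S' u).
  by rewrite mem_beyond (mem_tpath _ _ tE e'E cS').
case: (eqVneq s (S rt)) (eqVneq t (S' rt)) => [es|es] [et|et].
- constructor 3; apply/pred0P => u; rewrite /= De De'.
  have := st u; rewrite es et.
  by case: (S u); case: (S' u); case: (S rt); case: (S' rt); rewrite ?andbF.
- constructor 1; apply/subsetP => u; rewrite De De' => /andP[->].
  by have := st u; rewrite es; move: et;
    case: (S u); case: (S' u); case: (S rt); case: (S' rt); case: (t).
- constructor 2; apply/subsetP => u; rewrite De De' => /andP[->].
  by have := st u; rewrite et; move: es;
    case: (S u); case: (S' u); case: (S rt); case: (S' rt); case: (s).
- by have := st rt; rewrite eq_sym (negbTE es) eq_sym (negbTE et).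
Qed.

(** With [x] the old root and [v] the new one: rerooting complements the set of vertices beyond an
    edge on the path from [x] to [v] and changes nothing at the other edges. *)
Lemma mem_tpath_tree E e v u x : is_tree E -> e \in E ->
  (e \in tpath E v u) = ((e \in tpath E x v) != (e \in tpath E x u)).
Proof.
move=> tE eE; have [S cS] := tree_cut tE eE.
rewrite !(mem_tpath _ _ tE eE cS).
by case: (S v); case: (S u); case: (S x).
Qed.

Lemma tpath_refl E v : is_tree E -> tpath E v v = set0.
Proof.
move=> tE; apply/setP => e; rewrite in_set0; case: (boolP (e \in E)) => eE; last first.
  by rewrite inE (negbTE eE).
by have [S cS] := tree_cut tE eE; rewrite (mem_tpath _ _ tE eE cS) eqxx.
Qed.

Lemma tree_partial_fractions E (rt : V) (Vb : {set V}) (k : {set V} -> nat) :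
  is_tree E -> rt \in Vb -> ess_pos E Vb k ->
  exists2 L : seq (seq nat * seq V), all (is_chain (Vb :\ rt)) L &
    forall (R : comUnitRingType) (m : V -> R), unit_sums (Vb :\ rt) m ->
      \prod_(e in E) negpow (k e) (\sum_(v in Vb | e \in tpath E rt v) m v) =
      \sum_(x <- L) chain (@negpow R) x.1 (map m x.2).
Proof.
move=> tE rtV kpos.
have sumE (R : comUnitRingType) (m : V -> R) e :
    \sum_(v in Vb | e \in tpath E rt v) m v = \sum_(v in beyond E rt Vb e) m v.
  by apply: eq_bigl => v; rewrite mem_beyond.
(* An edge with positive exponent and no black vertex beyond it contributes [0 ^- k e = 0], which
   the empty list of chains reproduces. *)
case: (boolP [exists e in E, (0 < k e)%N && (beyond E rt Vb e == set0)]).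
  move=> /exists_inP[e eE /andP[ke /eqP De]]; exists [::] => // R m _.
  rewrite (bigD1 e) //= sumE De big_set0 big_nil /negpow expr0n gtn_eqF //.
  by rewrite invr0 mul0r.
rewrite negb_exists_in => /forall_inP D0.
pose F := flatten [seq nseq (k e) (beyond E rt Vb e) | e <- enum E].
have memF D : reflect (exists2 e, e \in E & (0 < k e)%N && (D == beyond E rt Vb e)) (D \in F).
  apply: (iffP flatten_mapP) => -[e]; rewrite ?mem_enum ?mem_nseq => eE h; exists e => //.
    by rewrite mem_enum.
  by rewrite mem_nseq.
have adm : admissible F (Vb :\ rt) rt.
  split.
  - move=> D /memF[e eE /andP[ke /eqP ->]]; split; last first.
      by have := D0 e eE; rewrite ke.
    apply/subsetP => u; rewrite mem_beyond in_setD1 => /andP[->]; rewrite andbT.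
    by apply: contraTneq => ->; rewrite tpath_refl // in_set0.
  - apply: (@laminar_beyond E rt Vb) => // D /memF[e eE /andP[_ /eqP ->]].
    exact: imset_f.
  - by rewrite !inE eqxx.
  (* Essential positivity yields an edge with [k e > 0] between [v] and [v']; the set beyond it
     separates them. *)
  rewrite setD1K // => v v' vV v'V ne.
  have := forall_inP (forall_inP kpos v vV) v' v'V; rewrite ne /= lt0n sum_nat_eq0.
  rewrite negb_forall => /existsP[e]; rewrite negb_imply -lt0n => /andP[ep ke].
  have eE : e \in E by move: ep; rewrite inE => /andP[].
  exists (beyond E rt Vb e); first by apply/memF; exists e; rewrite // ke eqxx.
  by rewrite !mem_beyond vV v'V; rewrite !andTb; move: ep; rewrite (mem_tpath_tree v v' rt tE eE).
have [L hL eL] := partial_fractions adm; exists L => // R m um.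
rewrite -eL // /F big_flatten big_map big_enum; apply: eq_bigr => e _.
by rewrite sumE big_nseq /negpow -exprVn; elim: (k e) => //= j <-; rewrite exprS.
Qed.

End TreeCuts.

(** * Truncated power series *)

Section TruncatedSeries.
Variable n : nat.

Definition tseries : Type := {poly %/ ('X^(n.+1) : {poly rat})}.
HB.instance Definition _ := GRing.ComUnitAlgebra.on tseries.

Definition tvar : tseries := in_qpoly ('X^(n.+1)) 'X.

Definition tcoef (p : tseries) : rat := (p : {poly rat})`_n.

Lemma tcoef_is_zmod_morphism : zmod_morphism tcoef.
Proof. by move=> p q; rewrite /tcoef coefB. Qed.

HB.instance Definition _ :=
  GRing.isZmodMorphism.Build tseries rat tcoef tcoef_is_zmod_morphism.

Lemma tvarX j : tvar ^+ j = in_qpoly ('X^(n.+1)) 'X^j.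
Proof. by rewrite rmorphXn. Qed.

Lemma tvar_eq0 j : (n < j)%N -> tvar ^+ j = 0.
Proof.
move=> nj; rewrite -(subnKC nj) exprD [tvar ^+ n.+1]tvarX.
suff -> : in_qpoly ('X^(n.+1)) ('X^(n.+1) : {poly rat}) = 0 by rewrite mul0r.
apply/val_eqP/eqP => /=; rewrite mk_monic_Xn.
by apply: Pdiv.RingMonic.rmodpp; apply: monicXn.
Qed.

Lemma tcoef_monomial c j : tcoef (c%:A * tvar ^+ j) = c * (j == n)%:R.
Proof.
case: (ltnP n j) => nj; first by rewrite tvar_eq0 // mulr0 raddf0 gtn_eqF // mulr0.
rewrite -scalerAl mul1r tvarX -linearZ /tcoef in_qpoly_small.
  by rewrite coefZ coefXn eq_sym.
rewrite mk_monic_Xn size_polyXn /=; apply: leq_ltn_trans (size_scale_leq _ _) _.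
by rewrite size_polyXn.
Qed.

End TruncatedSeries.

(** * Symmetrization of a tree *)

Lemma inH1_cat p q : inH1 p -> inH1 q -> inH1 (p ++ q).
Proof.
move=> hp hq u; rewrite coef_cat; case: (eqVneq (coef p u) 0) => [->|/hp //].
by rewrite add0r; apply: hq.
Qed.

Lemma inH1_scale c p : inH1 p -> inH1 (Hscale c p).
Proof. by move=> hp u; rewrite coef_scale mulf_eq0 negb_or => /andP[_ /hp]. Qed.

Lemma inH1_flatten (I : eqType) (r : seq I) (F : I -> Hel) :
  (forall i, i \in r -> inH1 (F i)) -> inH1 (flatten [seq F i | i <- r]).
Proof.
elim: r => [|i r IH] h; first by move=> u; rewrite /coef big_nil eqxx.
apply: inH1_cat; first by apply: h; rewrite mem_head.
by apply: IH => j jr; apply: h; rewrite inE jr orbT.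
Qed.

Section Main.
Variables (V : finType) (E : {set {set V}}) (rt : V) (Vb : {set V}).
Variable k : {set V} -> nat.
Hypotheses (tE : is_tree E) (rtV : rt \in Vb).

Let valid M (m : {ffun V -> 'I_M.+1}) :=
  [forall v, (v \in Vb) == (0 < m v)%N] && ((\sum_(v in Vb) (m v : nat))%N == M).

Definition shift_at (R : nzRingType) (v : V) (x : R) (m : V -> R) (u : V) : R :=
  m u + (if u == v then x else 0).

Lemma sum_shift_at (R : nzRingType) (v : V) (x : R) (m : V -> R) (A : pred V) :
  \sum_(u | A u) shift_at v x m u = \sum_(u | A u) m u + (if A v then x else 0).
Proof.
rewrite big_split /=; congr (_ + _); case: ifP => vA; last first.
  by rewrite big1 // => u uA; case: eqP => // e; rewrite -e uA in vA.
by rewrite (bigD1 v) //= eqxx big1 ?addr0 // => u /andP[_ /negbTE ->].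
Qed.

Lemma shifted_chain_map (R : unitRingType) (m : V -> nat) ks r s v (x : R) :
  uniq (r :: s) -> v \in r :: s ->
  chain (@negpow R) ks (map (shift_at v x (fun u => (m u)%:R)) s) =
  shifted_chain ks x (index v (r :: s)) (map m (r :: s)).
Proof.
move=> us vs; rewrite /shifted_chain; congr chain.
rewrite -[X in X = _]/(behead (map (shift_at v x (fun u => (m u)%:R)) (r :: s))).
congr behead; set s' := r :: s in us vs *.
have iv : (index v s' < size s')%N by rewrite index_mem.
have nv : nth v s' (index v s') = v by apply: nth_index.
move: (index v s') iv nv => i iv nv.
have [v1 v2] : v \notin take i s' /\ v \notin drop i.+1 s'.
  move: us; rewrite -{1}(cat_take_drop i s') (drop_nth v iv) nv cat_uniq /= negb_or.
  by case/and4P=> _ /andP[? _] ? _.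
rewrite -{1}(cat_take_drop i s') (drop_nth v iv) nv map_cat [map _ (v :: _)]/=.
have off w : {in w, forall u, u != v} ->
    map (shift_at v x (fun u => (m u)%:R)) w = map (fun j => j%:R) (map m w).
  move=> h; rewrite -map_comp; apply/eq_in_map => u /h /negbTE uv.
  by rewrite /shift_at uv addr0.
rewrite (off (take _ _)) => [|u uin]; last by apply: contraNneq v1 => e; move: uin; rewrite e.
rewrite (off (drop _ _)) => [|u uin]; last by apply: contraNneq v2 => e; move: uin; rewrite e.
by rewrite !map_take !map_drop (nth_map v) // nv /shift_at eqxx.
Qed.

Variables (L : seq (seq nat * seq V)).
Hypothesis hL : all (is_chain (Vb :\ rt)) L.
Hypothesis eL : forall (R : comUnitRingType) (m : V -> R), unit_sums (Vb :\ rt) m ->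
  \prod_(e in E) negpow (k e) (\sum_(v in Vb | e \in tpath E rt v) m v) =
  \sum_(x <- L) chain (@negpow R) x.1 (map m x.2).

(** The exponents are reversed because a chain starts at the root, where an index ends. *)
Definition word_of_chains : Hel := [seq (1, zw (rev x.1)) | x <- L].

Lemma chain_enum x : x \in L ->
  [/\ all (leq 1) x.1, size x.1 = size x.2, uniq (rt :: x.2) & rt :: x.2 =i Vb].
Proof.
move=> /(allP hL) /and4P[h1 /eqP h2 h3 /eqP/setP h4]; split => //=.
  by rewrite h3 andbT; have := h4 rt; rewrite !inE eqxx => ->.
move=> v; rewrite inE; have := h4 v; rewrite !inE => ->.
by case: eqP => [->|].
Qed.

Lemma inH1_word_of_chains : inH1 word_of_chains.
Proof. by apply: inH1_all; rewrite all_map; apply/allP => x _; apply: head_true_zw. Qed.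

Lemma valid_gt0 M (m : {ffun V -> 'I_M.+1}) v : valid m -> v \in Vb -> (0 < m v)%N.
Proof. by case/andP => /forallP/(_ v)/eqP <-. Qed.

Lemma valid_sum_gt0 M (m : {ffun V -> 'I_M.+1}) (A : pred V) v :
  valid m -> v \in Vb -> A v -> (0 < \sum_(u in Vb | A u) m u)%N.
Proof.
move=> hm vV vA; rewrite (bigD1 v) /= ?vV //; apply: leq_trans (leq_addr _ _).
exact: (valid_gt0 hm vV).
Qed.

(** The variable of the root takes what is left of [M], so the others have any total [b < M];
    summing the polylogarithm coefficients over these [b] gives [Z_M]. *)
Lemma ZM_word_of_chains M : (0 < M)%N -> ZM M word_of_chains = zeta E rt Vb k M.
Proof.
move=> M0; rewrite /zeta.
transitivity (\sum_(m : {ffun V -> 'I_M.+1} | valid m) \sum_(x <- L)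
    chain (@negpow rat) x.1 (map (fun u => (m u)%:R) x.2)); last first.
  apply: eq_bigr => m hm; rewrite -eL => [|A AV A0].
    apply: eq_bigr => e _; rewrite /negpow -natr_sum; congr (_ ^- _).
  have [v vA] := set0Pn _ A0.
  rewrite -natr_sum unitfE pnatr_eq0 -lt0n (bigD1 v) //=.
  apply: leq_trans (leq_addr _ _); apply: (valid_gt0 hm).
  by have /setD1P[] := subsetP AV _ vA.
rewrite exchange_big /= /ZM big_map big_seq [RHS]big_seq; apply: eq_bigr => x xL.
have [h1 h2 h3 h4] := chain_enum xL.
rewrite mul1r /ZMw wdec_zw ?all_rev //= /Zidx revK -sum_li_idx //.
have := sum_ffun_pcomps M
  (fun ms => chain (@negpow rat) x.1 (map (fun j => j%:R) (behead ms))) h3 h4.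
rewrite /= -h2 sum_pcompsS /=.
under [X in _ = X -> _]eq_bigr do rewrite (sum_chain_li_idx idfun) //.
move=> <-; apply: eq_bigr => m _; rewrite -map_comp; congr chain.
Qed.

Section Coefficient.
Variables (n M : nat).
Hypothesis M0 : (0 < M)%N.
Let T := tvar n.
Let x : tseries n := T - M%:R.

Let Tn : T ^+ n.+1 = 0. Proof. exact: tvar_eq0. Qed.

Lemma unit_sums_shift (m : {ffun V -> 'I_M.+1}) v : valid m -> v \in Vb ->
  unit_sums (Vb :\ rt) (shift_at v x (fun u => (m u)%:R)).
Proof.
move=> hm vV A AV A0; rewrite sum_shift_at -natr_sum.
have AVb : {subset A <= Vb} by move=> u /(subsetP AV) /setD1P[].
case: ifP => vA; last first.
  have [u uA] := set0Pn _ A0.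
  have s0 : (0 < \sum_(u in A) m u)%N.
    rewrite (bigD1 u) //=; apply: leq_trans (leq_addr _ _).
    by apply: (valid_gt0 hm); apply: AVb.
  rewrite addr0 -[_%:R]opprK unitrN -sub0r. 
  have -> : (\sum_(u in A) m u)%N%:R = in_alg (tseries n) (\sum_(u in A) m u)%N%:R.
    by rewrite rmorph_nat.
  by rewrite sub0r unitrN rmorph_unit // unitfE pnatr_eq0 -lt0n.
have /eqP eM : (\sum_(v in Vb) (m v : nat))%N == M by case/andP: hm.
have rtA : rt \notin A by apply/negP => /(subsetP AV); rewrite !inE eqxx.
have e : M = (\sum_(u in A) m u + \sum_(u in Vb | u \notin A) m u)%N.
  rewrite -[LHS]eM (bigID (mem A)) /=; congr (_ + _)%N; apply: eq_bigl => u.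
  by case: (boolP (u \in A)) => uA; rewrite ?andbF ?andbT // AVb.
rewrite /x [X in T - X](congr1 (fun N => N%:R) e) natrD.
have -> (a b : tseries n) : a + (T - (a + b)) = T - b by ring.
apply: (unit_subC Tn); exact: (valid_sum_gt0 hm rtV rtA).
Qed.

Lemma tcoef_shifted_sum :
  tcoef (\sum_(v in Vb) \sum_(m : {ffun V -> 'I_M.+1} | valid m) \prod_(e in E)
     negpow (k e) (\sum_(u in Vb | e \in tpath E rt u)
        shift_at v x (fun u => (m u)%:R) u)) =
  ZM M (phihat n word_of_chains).
Proof.
transitivity (tcoef (\sum_(v in Vb) \sum_(m : {ffun V -> 'I_M.+1} | valid m) \sum_(c <- L)
     chain (@negpow _) c.1 (map (shift_at v x (fun u => (m u)%:R)) c.2))).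
  congr tcoef; apply: eq_bigr => v vV; apply: eq_bigr => m hm.
  by rewrite eL //; apply: unit_sums_shift.
under eq_bigr do rewrite exchange_big.
rewrite exchange_big /= raddf_sum /phihat /word_of_chains -map_comp ZM_flatten.
rewrite big_seq [RHS]big_seq; apply: eq_bigr => c cL.
have [h1 h2 h3 h4] := chain_enum cL.
rewrite ZM_scale mul1r wdec_zw ?all_rev //=.
rewrite -(@chain_identity _ T n (@tcoef n) c.1 M Tn) //; last first.
  by move=> a j _; apply: tcoef_monomial.
congr tcoef; have -> : (size c.1).+1 = size (rt :: c.2) by rewrite /= h2.
(* The black vertices are the positions in [rt :: c.2], so the sum over [v] becomes the sum over
   cuts in [chain_identity]. *)
rewrite -(eq_bigl _ _ h4) -big_uniq // (big_nth rt) big_mkord.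
apply: eq_bigr => i _; rewrite -(sum_ffun_pcomps M _ h3 h4).
apply: eq_bigr => m _; rewrite (shifted_chain_map _ _ _ h3) ?mem_nth //.
by rewrite index_uniq.
Qed.

(** Defined for every set, as the constant series 1 off [E], because the functions [l] of [adm_l]
    live on all of [{set V}]. *)
Definition edge_coef (v : V) (m : {ffun V -> 'I_M.+1}) (e : {set V}) (l : nat) : rat :=
  let c := (\sum_(u in Vb | e \in tpath E v u) m u)%N in
  if e \in tpath E rt v then negpow_coef (k e) c l
  else if l == 0%N then (if e \in E then c%:R ^- k e else 1) else 0.

Lemma edge_factor v (m : {ffun V -> 'I_M.+1}) e : valid m -> v \in Vb -> e \in E ->
  negpow (k e) (\sum_(u in Vb | e \in tpath E rt u) shift_at v x (fun u => (m u)%:R) u) =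
  \sum_(l < n.+1) (edge_coef v m e l)%:A * T ^+ l.
Proof.
move=> hm vV eE; rewrite sum_shift_at /= vV -natr_sum /edge_coef /=.
have pathE u : (e \in tpath E v u) = ((e \in tpath E rt v) != (e \in tpath E rt u)).
  exact: mem_tpath_tree.
have /eqP eM : (\sum_(v in Vb) (m v : nat))%N == M by case/andP: hm.
case: ifP => ev.
  have e2 : M = (\sum_(u in Vb | e \in tpath E rt u) m u +
                \sum_(u in Vb | e \in tpath E v u) m u)%N.
    rewrite -[LHS]eM (bigID (fun u => e \in tpath E rt u)) /=; congr (_ + _)%N.
    by apply: eq_bigl => u; rewrite pathE ev.
  rewrite /x [X in T - X](congr1 (fun N => N%:R) e2) natrD.
  have -> (a b : tseries n) : a + (T - (a + b)) = T - b by ring.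
  rewrite (negpow_expand Tn) //; apply: valid_sum_gt0 hm rtV _.
  by rewrite pathE ev tpath_refl // in_set0.
rewrite addr0 big_ord_recl [X in _ = _ + X]big1 ?addr0 => [|l _]; last by rewrite /= scale0r mul0r.
rewrite /= eE mulr1 -[RHS]/(in_alg _ _) fmorphV rmorphXn rmorph_nat.
rewrite /negpow; congr (_%:R ^- _); apply: eq_bigl => u.
by rewrite pathE ev; case: (e \in tpath E rt u).
Qed.

Lemma tcoef_prod_edges v (m : {ffun V -> 'I_M.+1}) : valid m -> v \in Vb ->
  tcoef (\prod_(e in E)
     negpow (k e) (\sum_(u in Vb | e \in tpath E rt u)
        shift_at v x (fun u => (m u)%:R) u)) =
  \sum_(l | adm_l E rt v (n := n) l) (-1) ^+ ksum k (tpath E rt v) *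
     (bP E rt v k (fun e => nat_of_ord (l e)))%:R *
     \prod_(e in E) ((\sum_(u in Vb | e \in tpath E v u) (m u : nat))%N)%:R ^- (k e + l e).
Proof.
move=> hm vV.
have PE e : e \in tpath E rt v -> e \in E by rewrite inE => /andP[].
transitivity (tcoef (\prod_(e : {set V}) \sum_(l < n.+1) (edge_coef v m e l)%:A * T ^+ l)).
  congr tcoef; rewrite [RHS](bigID (mem E)) /= [X in _ = _ * X]big1 ?mulr1 => [|e nE].
    by apply: eq_bigr => e eE; apply: edge_factor.
  have eP : e \notin tpath E rt v by apply: contra nE => /PE.
  rewrite big_ord_recl big1 ?addr0 => [|l _]; last first.
    by rewrite /edge_coef (negbTE eP) /= scale0r mul0r.
  by rewrite /edge_coef (negbTE eP) (negbTE nE) /= mulr1 scale1r.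
(* Choosing a power of [T] for each set yields a function [l]. The coefficient of [T^n] requires
   total [n], and [edge_coef] vanishes unless [l] is 0 off the path, so only the admissible [l]
   remain. *)
rewrite bigA_distr_bigA /= raddf_sum.
transitivity (\sum_(l : {ffun {set V} -> 'I_n.+1})
    (\prod_(e : {set V}) edge_coef v m e (l e)) * ((\sum_(e : {set V}) l e)%N == n)%:R).
  apply: eq_bigr => l _; rewrite -tcoef_monomial; congr tcoef.
  rewrite big_split /= prodrXr -[(_)%:A in RHS]/(in_alg _ _) rmorph_prod.
  by [].
rewrite [LHS](bigID (adm_l E rt v (n := n))) /= [X in _ + X]big1 ?addr0 => [|l nl].
  apply: eq_bigr => l /andP[/forallP l0 /eqP ln].
  have lP e : e \notin tpath E rt v -> l e = 0%N :> nat.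
    by move=> eP; have := l0 e; rewrite eP => /eqP.
  have -> : (\sum_(e : {set V}) l e)%N = n.
    by rewrite (bigID (mem (tpath E rt v))) /= ln [X in (_ + X)%N]big1 ?addn0.
  rewrite eqxx mulr1 (bigID (mem E)) /= [X in _ * X]big1 ?mulr1 => [|e nE].
    rewrite (bigID (mem (tpath E rt v))) [\prod_(e in E) _](bigID (mem (tpath E rt v))) /=.
    rewrite mulrA; congr (_ * _); last first.
      apply: eq_bigr => e /andP[eE eP]; rewrite /edge_coef (negbTE eP) lP // eqxx eE.
      by rewrite addn0.
    have sel (F : {set V} -> rat) :
        \prod_(e | (e \in E) && (e \in tpath E rt v)) F e = \prod_(e in tpath E rt v) F e.
      by apply: eq_bigl => e; case: (boolP (e \in tpath E rt v)) => [/PE ->|]; rewrite ?andbF.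
    rewrite !sel /ksum /bP -prodrXr natr_prod -!big_split /=.
    by apply: eq_bigr => e eP; rewrite /edge_coef eP.
  have eP : e \notin tpath E rt v by apply: contra nE => /PE.
  by rewrite /edge_coef (negbTE eP) (negbTE nE) lP.
case: eqP => [ln|_]; last by rewrite mulr0.
suff [e eP le] : exists2 e, e \notin tpath E rt v & l e != 0%N :> nat.
  by rewrite (bigD1 e) //= /edge_coef (negbTE eP) (negbTE le) !mul0r.
move: nl; rewrite /adm_l negb_and negb_forall => /orP[/existsP[e]|].
  by rewrite negb_imply => /andP[eP le]; exists e.
move=> ne; apply/exists_inP; apply: contraR ne; rewrite negb_exists_in => /forall_inP h.
rewrite -[X in _ == X]ln [X in _ == X](bigID (mem (tpath E rt v))) /=.
by rewrite [X in (_ + X)%N]big1 ?addn0 // => e /h; rewrite negbK => /eqP.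
Qed.

End Coefficient.

End Main.

Theorem theorem1p2 (V : finType) (E : {set {set V}}) (rt : V) (Vb : {set V})
    (k : {set V} -> nat) (w : Hel) (W : V -> ({set V} -> nat) -> Hel) :
  is_tree E -> leaves_black E Vb -> rt \in Vb -> ess_pos E Vb k ->
  is_w E rt Vb k w ->
  (forall (v : V) (l : {set V} -> nat), v \in Vb ->
     (forall e, e \notin tpath E rt v -> l e = 0%N) ->
     is_w E v Vb (fun e => (k e + l e)%N) (W v l)) ->
  (forall (n : nat) (u : word), coef (phihat n w) u = coef (rhs E rt Vb k W n) u) /\
  (forall u : word,
     coef (phi w) u =
     coef (flatten [seq Hscale ((-1) ^+ ksum k (tpath E rt v)) (W v (fun _ => 0%N))
                   | v <- enum Vb]) u).
Proof.
move=> tE _ rtV kpos [hw Zw] hW.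
have [L hL eL] := tree_partial_fractions tE rtV kpos.
have admW n v (l : {ffun {set V} -> 'I_n.+1}) : v \in Vb -> adm_l E rt v l ->
    is_w E v Vb (fun e => (k e + l e)%N) (W v (fun e => nat_of_ord (l e))).
  move=> vV /andP[/forallP l0 _]; apply: hW => // e eP.
  by have := l0 e; rewrite eP => /eqP.
have hrhs n : inH1 (rhs E rt Vb k W n).
  apply: inH1_flatten => v; rewrite mem_enum => vV.
  apply: inH1_flatten => l; rewrite mem_enum => hl.
  by apply: inH1_scale; have [] := admW n v l vV hl.
have Zrhs n M : (0 < M)%N -> ZM M (phihat n (word_of_chains L)) = ZM M (rhs E rt Vb k W n).
  move=> M0; rewrite -(tcoef_shifted_sum rtV hL eL n M0) raddf_sum.
  rewrite /rhs ZM_flatten big_enum /=; apply: eq_bigr => v vV.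
  rewrite raddf_sum ZM_flatten big_enum /=.
  transitivity (\sum_(l | adm_l E rt v (n := n) l)
     (-1) ^+ ksum k (tpath E rt v) * (bP E rt v k (fun e => nat_of_ord (l e)))%:R *
     zeta E v Vb (fun e => (k e + l e)%N) M).
    under [RHS]eq_bigr do rewrite /zeta mulr_sumr.
    rewrite [RHS]exchange_big; apply: eq_bigr => m hm /=.
    exact: tcoef_prod_edges.
  apply: eq_bigr => l hl; rewrite ZM_scale; congr (_ * _).
  by have [_ ->] := admW n v l vV hl.
have Zw0 M : (0 < M)%N -> ZM M w = ZM M (word_of_chains L).
  by move=> M0; rewrite Zw // (ZM_word_of_chains rtV hL eL).
have main n u : coef (phihat n w) u = coef (rhs E rt Vb k W n) u.
  (* Separation is used twice: for the right-hand side against the symmetrization of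
     [word_of_chains], then for [w] against [word_of_chains], an equality that [coef_ext] carries
     through [phihat]. *)
  rewrite -(coef_eq_of_ZM (@inH1_phihat n (word_of_chains L)) (hrhs n) (Zrhs n)).
  rewrite !coef_phihat; apply: (coef_ext (fun a => coef (phiw n (wdec a).1) u)) => {}u.
  exact: (coef_eq_of_ZM hw (@inH1_word_of_chains V L) Zw0 u).
split=> // u; rewrite /phi main.
have W0 v : v \in Vb -> is_w E v Vb (fun e => (k e + 0)%N) (W v (fun _ => 0%N)).
  by move=> vV; apply: (hW v (fun _ => 0%N)).
(* [W] may return different lists at pointwise equal functions [l], so the two sides are again
   compared through [Z_M]. *)
apply: (coef_eq_of_ZM (hrhs 0%N)) => [|M M0].
  apply: inH1_flatten => v; rewrite mem_enum => vV.
  by apply: inH1_scale; have [] := W0 v vV.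
rewrite /rhs !ZM_flatten !big_enum; apply: eq_bigr => v vV.
rewrite ZM_flatten big_enum /= (big_pred1 [ffun => ord0]) => [|l]; last first.
  have l0 e : l e = ord0 by rewrite [l e]ord1.
  rewrite [LHS](_ : _ = true).
    by apply/esym/eqP/ffunP => e; rewrite ffunE l0.
  apply/andP; split; first by apply/forallP => e; rewrite l0 eqxx implybT.
  by rewrite big1 // => e _; rewrite l0.
rewrite !ZM_scale /bP big1 ?mulr1 => [|e _]; last by rewrite ffunE /= bin0.
congr (_ * _).
have [|_ ->] // := admW 0%N v [ffun => ord0] vV.
  apply/andP; split; first by apply/forallP => e; rewrite ffunE eqxx implybT.
  by rewrite big1 // => e _; rewrite ffunE.
have [_ ->] // := W0 v vV.
rewrite /zeta; apply: eq_bigr => m _; apply: eq_bigr => e _.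
by rewrite ffunE.
Qed.
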